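(* Suppose that there is an infinite set $\mathcal{N}$ of positive integers such that for every $n\in\mathcal{N}$, when all elliptic curves $E$ over $\mathbb{Q}$ are ordered by height, the average size of the $n$-Selmer group $S_n(E)$ is $\sigma(n)$, the sum of the positive divisors of $n$; i.e. $$\lim_{X\to\infty}\frac{\sum_{H(E)<X}\#S_n(E)}{\sum_{H(E)<X}1}=\sigma(n)\qquad\text{for all } n\in\mathcal{N}.$$ Then, when all elliptic curves over $\mathbb{Q}$ are ordered by height, a density of $100\%$ have rank $\le 1$; i.e. $$\lim_{X\to\infty}\frac{\#\{E:H(E)<X,\ \mathrm{rank}\,E(\mathbb{Q})\le 1\}}{\#\{E:H(E)<X\}}=1.$$
   Context: Any elliptic curve $E$ over $\mathbb{Q}$ is isomorphic to a unique curve $E_{A,B}:y^2=x^3+Ax+B$ with $A,B\in\mathbb{Z}$ such that for every prime $p$: $p^6\nmid B$ whenever $p^4\mid A$. The (naive) height is $H(E_{A,B}):=\max\{4|A^3|,27B^2\}$. Sums and counts are over isomorphism classes of elliptic curves over $\mathbb{Q}$. $S_n(E)$ denotes the $n$-Selmer group of $E$ over $\mathbb{Q}$. *)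

(* Defs.v *)
From HB Require Import structures.
From mathcomp Require Import all_boot all_order all_algebra all_field.
From mathcomp Require Import all_classical all_reals all_analysis.
From mathcomp Require Import ring.
Set Implicit Arguments.
Unset Strict Implicit.
Unset Printing Implicit Defensive.
Import Order.TTheory GRing.Theory Num.Theory.
Local Open Scope classical_set_scope.
Local Open Scope ring_scope.

(* The pair (A, B) stands for the curve E_{A,B} : y^2 = x^3 + A x + B; every
   isomorphism class of elliptic curves over Q contains exactly one E_{A,B}
   with (A, B) in [elliptic_curves]. *)
Definition weierstrass := (int * int)%type.

Definition elliptic_curves : set weierstrass :=
  [set E | 4 * E.1 ^+ 3 + 27 * E.2 ^+ 2 != 0 /\
     forall p : nat, prime p ->
       (p%:Z ^+ 4 %| E.1)%Z -> ~~ (p%:Z ^+ 6 %| E.2)%Z].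

Definition height (E : weierstrass) : int :=
  Num.max (4 * `|E.1 ^+ 3|) (27 * E.2 ^+ 2).

Definition curves_lt (R : realType) (X : R) : set weierstrass :=
  [set E | elliptic_curves E /\ (height E)%:~R < X].

Section Points.
Variables (E : weierstrass) (F : fieldType).
Local Notation a := (E.1%:~R : F).
Local Notation b := (E.2%:~R : F).

(* [None] is the point at infinity. *)
Definition on_curve (P : option (F * F)) : bool :=
  if P is Some (x, y) then y ^+ 2 == x ^+ 3 + a * x + b else true.

Record point := Point { point_val :> option (F * F); _ : on_curve point_val }.

HB.instance Definition _ := [isSub for point_val].
HB.instance Definition _ := [Choice of point by <:].

Definition opp_raw (P : option (F * F)) :=
  if P is Some (x, y) then Some (x, - y) else None.

Definition add_slope (l x1 y1 x2 : F) : option (F * F) :=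
  let x3 := l ^+ 2 - x1 - x2 in Some (x3, l * (x1 - x3) - y1).

Definition add_raw (P Q : option (F * F)) : option (F * F) :=
  match P, Q with
  | None, _ => Q
  | _, None => P
  | Some (x1, y1), Some (x2, y2) =>
      if x1 != x2 then add_slope ((y2 - y1) / (x2 - x1)) x1 y1 x2
      else if y1 == - y2 then None
      else add_slope ((3 * x1 ^+ 2 + a) / (2 * y1)) x1 y1 x2
  end.

Lemma on_curve_opp (P : point) : on_curve (opp_raw P).
Proof. by case: P => -[[x y]|] //=; rewrite sqrrN. Qed.

Lemma on_curve_add (P Q : point) : on_curve (add_raw P Q).
Proof.
case: P => -[[x1 y1]|] /= h1; case: Q => -[[x2 y2]|] //= h2.
move/eqP: h1 => h1; move/eqP: h2 => h2.
case: ifP => [x12|/negbFE/eqP x12].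
  have d : x2 - x1 != 0 by rewrite subr_eq0 eq_sym.
  have ha : a = (y2 ^+ 2 - y1 ^+ 2 - x2 ^+ 3 + x1 ^+ 3) / (x2 - x1).
    by rewrite h1 h2; field.
  have hb : b = y1 ^+ 2 - x1 ^+ 3 - a * x1 by rewrite h1; ring.
  by rewrite /add_slope /= hb ha; apply/eqP; field.
case: ifP => //= /eqP y12; subst x2.
have y0 : y1 + y2 != 0 by rewrite addr_eq0; apply/eqP.
have e : y1 = y2.
  apply/eqP; rewrite -subr_eq0 -(mulIr_eq0 _ (mulIf y0)) -subr_sqr h1 h2.
  by rewrite subrr.
have d : 2 * y1 != 0 by move: y0; rewrite -e -mulr2n mulr_natl.
set l := (3 * x1 ^+ 2 + a) / (2 * y1).
have hl : l * (2 * y1) = 3 * x1 ^+ 2 + a by rewrite divfK.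
rewrite /add_slope /= -subr_eq0; apply/eqP.
transitivity ((y1 ^+ 2 - (x1 ^+ 3 + a * x1 + b))
   + (l * (2 * y1) - (3 * x1 ^+ 2 + a)) * (l ^+ 2 - 3 * x1)).
  ring.
by rewrite h1 hl !subrr mul0r addr0.
Qed.

Definition point0 : point := @Point None isT.
Definition oppp (P : point) : point := Point (on_curve_opp P).
Definition addp (P Q : point) : point := Point (on_curve_add P Q).

Definition mulpn (P : point) (n : nat) : point := iter n (addp P) point0.
Definition mulpz (P : point) (m : int) : point :=
  match m with Posz n => mulpn P n | Negz n => oppp (mulpn P n.+1) end.

End Points.
Arguments point0 {E F}.

Section Rank.
Variable E : weierstrass.

Definition independent (r : nat) (P : 'I_r -> point E rat) : Prop :=
  forall m : 'I_r -> int,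
    \big[@addp E rat/point0]_(i < r) mulpz (P i) (m i) = point0 ->
    forall i, m i = 0.

(* The dimension of E(Q) (x) Q, as a supremum in the extended reals. *)
Definition rank (R : realType) : \bar R :=
  ereal_sup [set r%:R%:E | r in
    [set r : nat | exists P : 'I_r -> point E rat, independent P]].

End Rank.
Arguments rank E R : clear implicits.

Section BaseChange.
Variables (E : weierstrass) (F F' : fieldType) (f : {rmorphism F -> F'}).

Definition map_raw (P : option (F * F)) : option (F' * F') :=
  omap (fun xy => (f xy.1, f xy.2)) P.

Lemma on_curve_map (P : point E F) : on_curve E (map_raw P).
Proof.
case: P => -[[x y]|] //= /eqP h; apply/eqP.
by rewrite -rmorphXn h !rmorphD rmorphM rmorphXn !rmorph_int.
Qed.

Definition map_point (P : point E F) : point E F' := Point (on_curve_map P).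

End BaseChange.

Section Galois.
Variables (K L : fieldType) (i : {rmorphism K -> L}).

Record gal := Gal {
  gal_map :> {rmorphism L -> L};
  gal_bij : bijective gal_map;
  gal_fix : forall x, gal_map (i x) = i x }.

Lemma gal_mul_fix (s t : gal) x : (s \o t) (i x) = i x.
Proof. by rewrite /= !gal_fix. Qed.

Definition gal_mul (s t : gal) : gal :=
  @Gal (s \o t) (bij_comp (gal_bij s) (gal_bij t)) (gal_mul_fix s t).

(* Continuity for the Krull topology on the source and the discrete topology
   on the target. *)
Definition krull_continuous (T : Type) (c : gal -> T) : Prop :=
  forall s : gal, exists l : seq L, forall t : gal, {in l, s =1 t} -> c t = c s.

Definition coboundary (E : weierstrass) (P : point E L) (s : gal) : point E L :=
  addp (map_point s P) (oppp P).

End Galois.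

Section Cohomology.
Variables (E : weierstrass) (n : nat).

Definition galQ := gal (ratr : {rmorphism rat -> algC}).

(* Continuous 1-cocycles of Gal(Qbar/Q) with values in E[n]. *)
Definition Z1 : set (galQ -> point E algC) :=
  [set c | [/\ forall s, mulpn (c s) n = point0,
              krull_continuous c &
              forall s t, c (gal_mul s t) = addp (c s) (map_point s (c t))]].

Definition cohomologous (c c' : galQ -> point E algC) : Prop :=
  exists2 T : point E algC, mulpn T n = point0 &
    forall s, c' s = addp (c s) (coboundary T s).

Definition H1_class (c : galQ -> point E algC) : set (galQ -> point E algC) :=
  [set c' | Z1 c' /\ cohomologous c c'].

End Cohomology.

Section Places.
Variable R : realType.

(* [None] is the archimedean place and [Some p] the place of the prime p. *)
Definition is_place (v : option nat) : Prop :=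
  if v is Some p then prime p else True.

Definition abs_at (v : option nat) (q : rat) : R :=
  if v is Some p then
    if q == 0 then 0
    else p%:R ^+ logn p `|denq q| / p%:R ^+ logn p `|numq q|
  else `|ratr q|.

(* The completion of Q at v, characterised up to unique isometric isomorphism. *)
Record is_completion (v : option nat) (K : fieldType)
    (i : {rmorphism rat -> K}) (abs : K -> R) : Prop := IsCompletion {
  compl_abs0 : forall x, abs x = 0 <-> x = 0;
  compl_absM : forall x y, abs (x * y) = abs x * abs y;
  compl_absD : forall x y, abs (x + y) <= abs x + abs y;
  compl_absQ : forall q, abs (i q) = abs_at v q;
  compl_dense : forall x e, 0 < e -> exists q, abs (x - i q) < e;
  compl_complete : forall u : nat -> K,
    (forall e, 0 < e -> exists N : nat,
       forall m n, (N <= m)%N -> (N <= n)%N -> abs (u m - u n) < e) ->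
    exists l, forall e, 0 < e -> exists N : nat,
      forall n, (N <= n)%N -> abs (u n - l) < e }.

(* The image of the class of c in H^1(Q_v, E) is trivial. Here K = Q_v, L is an
   algebraic closure of K and j an embedding of Qbar in L; the property does
   not depend on these choices. The automorphism t is the restriction of s
   along j. *)
Definition trivial_at (E : weierstrass) (v : option nat)
    (c : galQ -> point E algC) : Prop :=
  forall (K : fieldType) (i : {rmorphism rat -> K}) (abs : K -> R),
    is_completion v i abs ->
  forall (L : closedFieldType) (k : {rmorphism K -> L}),
    (forall x, algebraicOver k x) ->
  forall j : {rmorphism algC -> L},
  exists P : point E L, forall (s : gal k) (t : galQ),
    (forall x, s (j x) = j (t x)) -> map_point j (c t) = coboundary P s.

(* The kernel of H^1(Q, E[n]) -> prod_v H^1(Q_v, E). *)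
Definition selmer (E : weierstrass) (n : nat) : set (set (galQ -> point E algC)) :=
  [set H1_class n c | c in
    [set c | Z1 n c /\ forall v, is_place v -> trivial_at v c]].

End Places.
Arguments selmer R E n : clear implicits.

(* Main.v *)
(* Descent: a pair of independent points of E(Q) gives n ^ 2 classes in
   E(Q) / n E(Q), hence n ^ 2 elements in the n-Selmer group, through the Kummer
   map. So if the proportion of curves of rank at least 2 had a positive upper
   density d, the average size of the n-Selmer group would be at least d n ^ 2,
   while sigma(n) = o(n ^ 2).
   That E(Q) / n E(Q) has at least n ^ 2 classes is obtained from the canonical
   height: the two shortest independent vectors Q1, Q2 of E(Q) satisfy
   a Q1 + b Q2 in n E(Q) only if n divides a and b. *)
Require Import Defs.
From HB Require Import structures.
From mathcomp Require Import all_boot all_order all_algebra all_field.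
From mathcomp Require Import all_classical all_reals all_analysis.
From mathcomp Require Import ring lra zify.
Set Implicit Arguments.
Unset Strict Implicit.
Unset Printing Implicit Defensive.
Import Order.TTheory GRing.Theory Num.Theory.
Local Open Scope ring_scope.

(** * The group law *)

(** Independence alone does not give n ^ 2 classes: independent points may well be divisible by n.
    The reduced pair cures this for all n at once and whatever the torsion of E(Q). Its vectors
    exist because a bound on the height leaves finitely many points; the exact parallelogram law of
    the canonical height then turns divisibility by n into an inequality for a binary quadratic
    form. The Kummer class of P is s |-> s T - T, where T in E(Qbar) satisfies n T = P. So E(Qbar)
    has to be divisible, and T itself trivialises the class in E at every place. Two points of E(Q)
    with the same class differ by an element of n E(Q), since Galois-invariant points are rational.
    All of this presupposes that the chord and tangent law is a group law. Associativity is derived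
    from products of ideals in the affine coordinate ring, which confines the distinction between
    chords and tangents to the construction of the line through two points. *)

(* A pair (u, v) stands for u(x) + v(x) y in F[x, y] / (y ^ 2 - w(x)). *)
Definition coord (F : fieldType) (w : {poly F}) : Type := ({poly F} * {poly F})%type.

Section CoordinateRing.
Variables (F : fieldType) (w : {poly F}).
Local Notation C := (coord w).

HB.instance Definition _ := GRing.Zmodule.copy C ({poly F} * {poly F})%type.

Definition coord_one : C := (1, 0).
Definition coord_mul (f g : C) : C :=
  (f.1 * g.1 + w * f.2 * g.2, f.1 * g.2 + f.2 * g.1).

Fact coord_mulA : associative coord_mul.
Proof. by move=> f g h; congr pair => /=; ring. Qed.

Fact coord_mulC : commutative coord_mul.
Proof. by move=> f g; congr pair => /=; ring. Qed.

Fact coord_mul1 : left_id coord_one coord_mul.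
Proof. by move=> [f1 f2]; congr pair => /=; ring. Qed.

Fact coord_mulDl : left_distributive coord_mul +%R.
Proof. by move=> f g h; congr pair => /=; ring. Qed.

Fact coord_one_neq0 : coord_one != 0.
Proof. by rewrite xpair_eqE oner_eq0. Qed.

HB.instance Definition _ := GRing.Zmodule_isComNzRing.Build C
  coord_mulA coord_mulC coord_mul1 coord_mulDl coord_one_neq0.

Definition cst (p : {poly F}) : C := (p, 0).

Fact cst_is_additive : zmod_morphism cst.
Proof. by move=> p q; congr pair; rewrite subr0. Qed.

Fact cst_is_multiplicative : monoid_morphism cst.
Proof. by split=> // p q; congr pair => /=; ring. Qed.

HB.instance Definition _ := GRing.isZmodMorphism.Build _ _ cst cst_is_additive.
HB.instance Definition _ :=
  GRing.isMonoidMorphism.Build _ _ cst cst_is_multiplicative.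

Definition conjc (f : C) : C := (f.1, - f.2).
Definition normc (f : C) : {poly F} := f.1 ^+ 2 - w * f.2 ^+ 2.

Lemma coordM (f1 f2 g1 g2 : {poly F}) :
  ((f1, f2) : C) * (g1, g2) = (f1 * g1 + w * f2 * g2, f1 * g2 + f2 * g1).
Proof. by []. Qed.

Lemma conjcD f g : conjc (f + g) = conjc f + conjc g.
Proof. by congr pair => /=; ring. Qed.

Lemma conjcM f g : conjc (f * g) = conjc f * conjc g.
Proof. by congr pair => /=; ring. Qed.

Lemma normc_conj f : normc (conjc f) = normc f.
Proof. by rewrite /normc /=; ring. Qed.

Lemma normcM f g : normc (f * g) = normc f * normc g.
Proof. by rewrite /normc /=; ring. Qed.

Lemma normc_cst p : normc (cst p) = p ^+ 2.
Proof. by rewrite /normc /=; ring. Qed.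

End CoordinateRing.

(** * Ideals of points in the affine coordinate ring *)

Section GroupLaw.
Variables (E : weierstrass) (F : numFieldType).
Hypothesis disc_neq0 : 4 * E.1 ^+ 3 + 27 * E.2 ^+ 2 != 0.
Local Notation a := (E.1%:~R : F).
Local Notation b := (E.2%:~R : F).
Local Notation pt := (Defs.point E F).

Definition cubic : {poly F} := 'X^3 + a%:P * 'X + b%:P.
Local Notation w := cubic.
Local Notation C := (coord w).

Lemma discr_neq0 : 4 * a ^+ 3 + 27 * b ^+ 2 != 0.
Proof.
have : (4 * E.1 ^+ 3 + 27 * E.2 ^+ 2)%:~R != 0 :> F by rewrite intr_eq0.
by apply: contraNneq => <-; apply/eqP; ring.
Qed.

(** The affine ring does not see the point at infinity, whose ideal is taken to be the whole ring.
    Accordingly [xfun] below is 1 there, and elsewhere the vertical line through P, which generates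
    the product of the ideals of P and its opposite. *)
Definition vanish (P : option (F * F)) (f : C) : Prop :=
  if P is Some (x, y) then f.1.[x] + y * f.2.[x] = 0 else True.

Definition xfun (P : option (F * F)) : {poly F} :=
  if P is Some (x, y) then 'X - x%:P else 1.

(* [mem_prod L f]: f belongs to the product of the ideals of the points of L. *)
Inductive mem_prod : seq pt -> C -> Prop :=
| mem_nil f : mem_prod [::] f
| mem_cons (P : pt) L f g : vanish P f -> mem_prod L g -> mem_prod (P :: L) (f * g)
| mem_add L f g : mem_prod L f -> mem_prod L g -> mem_prod L (f + g).

Lemma horner_cubic x : w.[x] = x ^+ 3 + a * x + b.
Proof. by rewrite /cubic !hornerE. Qed.

Lemma curve_eq x y (P : pt) : point_val P = Some (x, y) -> y ^+ 2 = w.[x].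
Proof. by case: P => /= P h e; move: h; rewrite e horner_cubic => /eqP. Qed.

Implicit Types (P Q : pt) (L : seq pt) (f g h : C).

Lemma vanishM (P : pt) f g : vanish P f -> vanish P (g * f).
Proof.
case e: (point_val P) => [[x y]|] //= h; have := curve_eq e.
rewrite !hornerE => <-.
transitivity ((f.1.[x] + y * f.2.[x]) * (g.1.[x] + y * g.2.[x])); first by ring.
by rewrite h mul0r.
Qed.

Lemma vanish_conj (P : pt) f : vanish P f -> vanish (oppp P) (conjc f).
Proof. by case: P => -[[x y]|] //= h <-; rewrite hornerE; ring. Qed.

Lemma mem_prodM L f g : mem_prod L f -> mem_prod L (g * f).
Proof.
move=> h; elim: h => {L f} [f|P L f h Pf Lh IH|L f h Lf IHf Lh IHh].
- exact: mem_nil.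
- by rewrite mulrCA; apply: mem_cons.
- by rewrite mulrDr; apply: mem_add.
Qed.

Lemma mem_prodN L f : mem_prod L f -> mem_prod L (- f).
Proof. by rewrite -mulN1r; apply: mem_prodM. Qed.

Lemma mem_prodB L f g : mem_prod L f -> mem_prod L g -> mem_prod L (f - g).
Proof. by move=> hf /mem_prodN; apply: mem_add. Qed.

Lemma mem_prod_cat L1 L2 f g :
  mem_prod L1 f -> mem_prod L2 g -> mem_prod (L1 ++ L2) (f * g).
Proof.
move=> h hg; elim: h => {L1 f} [f|P L f h Pf Lh IH|L f h Lf IHf Lh IHh].
- exact: mem_prodM.
- by rewrite -mulrA; apply: mem_cons.
- by rewrite mulrDl; apply: mem_add.
Qed.

Lemma mem_prod_consE P L f (S : C -> Prop) :
    (forall g h, vanish P g -> mem_prod L h -> S (g * h)) ->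
    (forall g h, S g -> S h -> S (g + h)) ->
  mem_prod (P :: L) f -> S f.
Proof.
move=> SM SD h; move eM: (P :: L) h => M h.
elim: h eM => {M f} [|Q M f g Qf Mg _ [eP eL]|M f g _ IHf _ IHg eM] //.
- by apply: SM; rewrite ?eP ?eL.
- by apply: SD; [apply: IHf | apply: IHg].
Qed.

Lemma mem_prod_swap P Q L f : mem_prod [:: P, Q & L] f -> mem_prod [:: Q, P & L] f.
Proof.
apply: mem_prod_consE => [g h Pg|g h]; last exact: mem_add.
apply: (@mem_prod_consE _ _ _ (fun h => mem_prod _ (g * h))) => [h1 h2 Qh1 Lh2|h1 h2].
  by rewrite mulrCA; do 2![apply: mem_cons => //].
by rewrite mulrDr; apply: mem_add.
Qed.

Lemma mem_prod_sub P L L' f : (forall g, mem_prod L g -> mem_prod L' g) ->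
  mem_prod (P :: L) f -> mem_prod (P :: L') f.
Proof.
move=> sLL'; apply: mem_prod_consE => [g h Pg /sLL'|g h]; last exact: mem_add.
exact: mem_cons.
Qed.

Lemma mem_prod_rot (P : pt) L1 L2 f :
  mem_prod (P :: L1 ++ L2) f <-> mem_prod (L1 ++ P :: L2) f.
Proof.
elim: L1 f => [|Q L1 IH] f //=; split.
  by move/mem_prod_swap; apply: mem_prod_sub => g /IH.
by move=> h; apply: mem_prod_swap; apply: mem_prod_sub h => g /IH.
Qed.

Lemma mem_prod_perm L L' f : perm_eq L L' -> mem_prod L f -> mem_prod L' f.
Proof.
elim: L L' f => [|P L IH] L' f.
  by rewrite perm_sym => /perm_nilP ->.
move=> /[dup] /perm_mem /(_ P); rewrite mem_head => /esym /path.splitPr [L1 L2].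
rewrite perm_sym perm_catC /= perm_cons perm_catC perm_sym => eL h.
by apply/mem_prod_rot; apply: mem_prod_sub h => g; apply: IH.
Qed.

Lemma mem_prod_conj L f : mem_prod L f -> mem_prod (map (@oppp E F) L) (conjc f).
Proof.
move=> h; elim: h => {L f} [f|P L f h Pf Lh IH|L f h Lf IHf Lh IHh] /=.
- exact: mem_nil.
- by rewrite conjcM; apply: mem_cons => //; apply: vanish_conj.
- by rewrite conjcD; apply: mem_add.
Qed.

Lemma vanish_mem_prod P L f : mem_prod (P :: L) f -> vanish P f.
Proof.
apply: mem_prod_consE => [g h Pg _|g h]; first by rewrite mulrC; apply: vanishM.
by case: (point_val P) => [[x y]|] //= hg hh; rewrite !hornerE mulrDr addrACA hg hh addr0.
Qed.

Lemma vanishE (P : pt) x y f : point_val P = Some (x, y) -> vanish P f ->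
  exists p q, f = cst w p * cst w ('X - x%:P) + cst w q * (- y%:P, 1).
Proof.
move=> -> /= h.
have /factor_theorem[p hp] : root (f.1 + y%:P * f.2) x by rewrite rootE !hornerE h.
exists p, f.2; case: f h hp => f1 f2 /= _ hp; congr pair => /=; last by ring.
by apply: (addIr (y%:P * f2)); rewrite hp; ring.
Qed.

(** Cancellation of a point against its opposite: their ideals are generated by X - x and Y - y,
    respectively X - x and Y + y, and every product of generators is a multiple of X - x, the only
    nontrivial case being (Y - y) (Y + y) = w(X) - w(x). *)
Lemma mem_prod_cancel P L f : mem_prod [:: P, oppp P & L] f ->
  exists2 g, mem_prod L g & f = cst w (xfun P) * g.
Proof.
apply: (@mem_prod_consE _ _ _
    (fun f => exists2 g, mem_prod L g & f = cst w (xfun P) * g)) =>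
  [g h Pg|g h [g' Lg' ->] [h' Lh' ->]]; last first.
  by exists (g' + h'); rewrite ?mulrDr //; apply: mem_add.
apply: (@mem_prod_consE _ _ _
    (fun h => exists2 k, mem_prod L k & g * h = cst w (xfun P) * k)) =>
  [h1 h2 Qh1 Lh2|h1 h2]; last first.
  move=> [k1 Lk1 e1] [k2 Lk2 e2]; exists (k1 + k2); first exact: mem_add.
  by rewrite !mulrDr e1 e2.
case e: (point_val P) => [[x y]|] /=; last first.
  by exists (g * (h1 * h2)); [rewrite mulrA; apply: mem_prodM | rewrite rmorph1 mul1r].
have [p [q ->]] := vanishE e Pg.
have e' : point_val (oppp P) = Some (x, - y) by rewrite /= e.
have [r [s ->]] := vanishE e' Qh1.
have /factor_theorem[t ht] : root (w - (y ^+ 2)%:P) x.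
  by rewrite rootE !hornerE (curve_eq e) horner_cubic subrr.
exists ((cst w p * (cst w r * cst w ('X - x%:P) + cst w s * (- (- y)%:P, 1))
  + cst w q * (- y%:P, 1) * cst w r + cst w q * cst w s * cst w t) * h2).
  exact: mem_prodM.
have Y : ((- y%:P, 1) : C) * (- (- y)%:P, 1) = cst w t * cst w ('X - x%:P).
  by rewrite -rmorphM /= -ht; congr pair => /=; rewrite ?polyCN; ring.
rewrite mulrA mulrA; congr (_ * h2).
by move: Y; set u := (- y%:P, 1); set v := (_, 1) => Y; ring: Y.
Qed.
(** Smoothness in the form of a Bezout relation between [w] and its derivative; in [mem_prod_line]
    it deals with coinciding intersection points uniformly. *)
Lemma discr_bezout : (4 * a ^+ 3 + 27 * b ^+ 2)%:P =
  (27 * b%:P - 18 * a%:P * 'X) * w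
    + (6 * a%:P * 'X^2 - 9 * b%:P * 'X + 4 * a%:P ^+ 2) * (3 * 'X^2 + a%:P).
Proof. by rewrite /cubic; ring. Qed.

Lemma cubic_simple_root x : x ^+ 3 + a * x + b = 0 -> 3 * x ^+ 2 + a != 0.
Proof.
move=> e0; apply: contraNneq discr_neq0 => e1; apply/eqP.
transitivity ((27 * b - 18 * a * x) * (x ^+ 3 + a * x + b)
    + (6 * a * x ^+ 2 - 9 * b * x + 4 * a ^+ 2) * (3 * x ^+ 2 + a)); first by ring.
by rewrite e0 e1; ring.
Qed.

Lemma mem_prodZ L c f : c != 0 -> mem_prod L (cst w c%:P * f) -> mem_prod L f.
Proof.
move=> c0 /(mem_prodM (cst w c^-1%:P)).
by rewrite mulrA -rmorphM -polyCM mulVf // rmorph1 mul1r.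
Qed.

(** The hypotheses compare the coefficients of X ^ 2, X and 1 in w - m ^ 2 = (X - x1) (X - x2) (X -
    x3). The second conclusion is the derivative of the first, for use with [discr_bezout]. *)
Lemma cubic_line x1 x2 x3 l n (m : {poly F} := l%:P * 'X + n%:P) :
    l ^+ 2 = x1 + x2 + x3 -> a - 2 * l * n = x1 * x2 + (x1 + x2) * x3 ->
    b - n ^+ 2 = - (x1 * x2 * x3) ->
  w - m ^+ 2 = ('X - x1%:P) * ('X - x2%:P) * ('X - x3%:P) /\
    3 * 'X^2 + a%:P = 2 * l%:P * m + ('X - x2%:P) * ('X - x3%:P)
      + ('X - x1%:P) * ('X - x3%:P) + ('X - x1%:P) * ('X - x2%:P).
Proof.
move=> h2 h1 h0.
have -> : w = 'X^3 + (x1 * x2 + (x1 + x2) * x3 + 2 * l * n)%:P * 'X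
    + (- (x1 * x2 * x3) + n ^+ 2)%:P by rewrite -h1 -h0 !subrK.
have -> : a = x1 * x2 + (x1 + x2) * x3 + 2 * l * n by rewrite -h1 subrK.
have -> : x3 = l ^+ 2 - x1 - x2 by rewrite h2; ring.
by rewrite /m; split; ring.
Qed.

(* The elements g with g * line in the product of the three ideals form an ideal,
   which turns out to contain the square of the discriminant. *)
Lemma mem_prod_line P Q T x1 x2 x3 l n (m : {poly F} := l%:P * 'X + n%:P) :
    point_val P = Some (x1, m.[x1]) -> point_val Q = Some (x2, m.[x2]) ->
    point_val T = Some (x3, m.[x3]) ->
    l ^+ 2 = x1 + x2 + x3 -> a - 2 * l * n = x1 * x2 + (x1 + x2) * x3 ->
    b - n ^+ 2 = - (x1 * x2 * x3) ->
  mem_prod [:: P; Q; T] (- m, 1).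
Proof.
move=> eP eQ eT h2 h1 h0; have [fac dfac] := cubic_line h2 h1 h0.
rewrite -/m in fac dfac; clearbody m => {h0 h1 h2}; set M := mem_prod _.
pose line : C := (- m, 1); pose X x : C := cst w ('X - x%:P).
have V (Z : pt) x : point_val Z = Some (x, m.[x]) -> vanish Z line /\ vanish Z (X x).
  by move=> -> /=; rewrite hornerN hornerC horner0 hornerXsubC; split; ring.
have [[vP1 vP2] [vQ1 vQ2] [vT1 vT2]] := And3 (V _ _ eP) (V _ _ eQ) (V _ _ eT).
have M3 f g h k : vanish P f -> vanish Q g -> vanish T h -> M (k * (f * (g * h))).
  move=> Pf Qg Th; apply: mem_prodM; do 2![apply: mem_cons => //].
  by rewrite -[h]mulr1; apply: mem_cons => //; apply: mem_nil.
pose A : C := cst w (27 * b%:P - 18 * a%:P * 'X).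
pose B : C := cst w (6 * a%:P * 'X^2 - 9 * b%:P * 'X + 4 * a%:P ^+ 2).
pose line' : C := (m, 1).
have eprod : line * line' = X x1 * (X x2 * X x3).
  by rewrite /X mulrA -!rmorphM /= -fac /line coordM; congr pair; ring.
have eline : 2 * cst w m = line' - line.
  by rewrite -[2](rmorph_nat (cst w)) -rmorphM /=; congr pair => /=; ring.
have ew : cst w w = cst w m ^+ 2 + X x1 * (X x2 * X x3).
  by rewrite /X -rmorphXn -!rmorphM -rmorphD /= [X in _ + X]mulrA -fac addrC subrK.
have ew' : cst w (3 * 'X^2 + a%:P) = 2 * cst w l%:P * cst w m
    + X x2 * X x3 + X x1 * X x3 + X x1 * X x2.
  by rewrite dfac 3!rmorphD 5!rmorphM rmorph_nat.
set D := 4 * a ^+ 3 + 27 * b ^+ 2.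
have eD : cst w D%:P = A * cst w w + B * cst w (3 * 'X^2 + a%:P).
  by rewrite /D discr_bezout rmorphD !rmorphM.
have m2line : M (4 * cst w m ^+ 2 * line).
  have -> : 4 * cst w m ^+ 2 * line = 2 * cst w m * (X x1 * (X x2 * X x3))
      - line * (X x1 * (X x2 * X x3)) + 1 * (line * (line * line)).
    transitivity ((2 * cst w m) ^+ 2 * line); first by ring.
    by rewrite -eprod eline; ring.
  apply: mem_add; last exact: M3.
  by apply: mem_prodB; apply: M3.
(* Expanding 4 D line through [eD] gives terms that visibly lie in the product ideal, collected in
   [t], and the multiple 8 l B m line. Multiplying by D and substituting once more turns m into m ^
   2, where [m2line] applies. *)
pose t := A * (4 * cst w m ^+ 2 * line) + 4 * A * line * (X x1 * (X x2 * X x3))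
  + 4 * B * (line * (X x2 * X x3)) + 4 * B * (X x1 * (line * X x3))
  + 4 * B * (X x1 * (X x2 * line)).
have Mt : M t.
  by rewrite /t; repeat apply: mem_add; first [exact: mem_prodM | exact: M3].
have e : 4 * cst w D%:P * line = t + 8 * cst w l%:P * B * cst w m * line.
  by rewrite eD ew ew' /t; ring.
apply: (@mem_prodZ _ (4 * D ^+ 2)).
  by rewrite mulf_neq0 ?pnatr_eq0 // expf_neq0 // discr_neq0.
have -> : cst w (4 * D ^+ 2)%:P * line = (cst w D%:P + 2 * cst w l%:P * B * cst w m) * t
    + (4 * cst w l%:P ^+ 2 * B ^+ 2) * (4 * cst w m ^+ 2 * line).
  transitivity (cst w D%:P * (4 * cst w D%:P * line)).
    by clearbody D; ring.
  transitivity (cst w D%:P * t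
      + 2 * cst w l%:P * B * cst w m * (4 * cst w D%:P * line)).
    by rewrite [in LHS]e; clearbody D t line B; ring.
  by rewrite e; clearbody D t line B; ring.
by apply: mem_add; apply: mem_prodM.
Qed.

(** For y != 0 the combination (Y + y) - (Y - y) = 2 y is invertible. For y = 0 the two ideals
    coincide and smoothness enters: Y ^ 2 - (X + 2 x) (X - x) ^ 2 = (3 x ^ 2 + a) (X - x), with 3 x
    ^ 2 + a invertible. *)
Lemma mem_prod_vertical P : mem_prod [:: P; oppp P] (cst w (xfun P)).
Proof.
case eP: (point_val P) => [[x y]|] /=; last first.
  rewrite rmorph1 -(mulr1 1); apply: mem_cons; first by rewrite eP.
  by rewrite -(mulr1 1); apply: mem_cons; [rewrite /= eP | apply: mem_nil].
set M := mem_prod _; set X := cst w _.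
pose u : C := (- y%:P, 1); pose v : C := (y%:P, 1).
have M2 f g k : vanish P f -> vanish (oppp P) g -> M (k * (f * g)).
  move=> Pf Qg; apply: mem_prodM; rewrite -[g]mulr1.
  by do 2![apply: mem_cons => //]; apply: mem_nil.
have [PX Pu] : vanish P X /\ vanish P u.
  by rewrite eP /= !hornerE; split; ring.
have [QX Qv] : vanish (oppp P) X /\ vanish (oppp P) v.
  by rewrite /= eP /= !hornerE; split; ring.
have [y0|y0] := eqVneq y 0; last first.
  apply: (@mem_prodZ _ (2 * y)); first by rewrite mulf_neq0 ?pnatr_eq0.
  have -> : cst w (2 * y)%:P * X = 1 * (X * v) - 1 * (u * X).
    have -> : cst w (2 * y)%:P = v - u.
      by congr pair => /=; rewrite ?polyCM; ring.
    by ring.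
  by apply: mem_prodB; apply: M2.
have e0 : x ^+ 3 + a * x + b = 0 by rewrite -horner_cubic -(curve_eq eP) y0 expr0n.
apply: (mem_prodZ (cubic_simple_root e0)).
have -> : cst w (3 * x ^+ 2 + a)%:P * X
    = 1 * (u * v) - cst w ('X + (2 * x)%:P) * (X * X).
  rewrite mul1r coordM /X -!rmorphM /=; congr pair => /=; last by rewrite y0; ring.
  have -> : w = ('X - x%:P) * ('X^2 + x%:P * 'X + (x ^+ 2 + a)%:P).
    transitivity (w - (x ^+ 3 + a * x + b)%:P); first by rewrite e0 subr0.
    by rewrite /cubic; ring.
  by rewrite y0; ring.
by apply: mem_prodB; apply: M2.
Qed.

(** * The lines of the group law, and associativity *)

Lemma xfun_opp P : xfun (oppp P) = xfun P.
Proof. by case: P => -[[x y]|]. Qed.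

Lemma oppp0 : oppp (point0 : pt) = point0.
Proof. exact: val_inj. Qed.

Lemma addp0 P : addp P point0 = P.
Proof. by apply: val_inj; case: P => -[[x y]|]. Qed.

Lemma add0p P : addp point0 P = P.
Proof. by apply: val_inj; case: P => -[[x y]|]. Qed.

Lemma addpC P Q : addp P Q = addp Q P.
Proof.
apply: val_inj; case: P => -[[x1 y1]|] h1; case: Q => -[[x2 y2]|] h2 //=.
rewrite (eq_sym x2); case: ifP => [x12|/negbFE/eqP x12]; last first.
  subst x2; rewrite (eq_sym y2) eqr_oppLR; case: ifP => [//|/negbT y12].
  have -> // : y1 = y2.
  apply/eqP; rewrite -subr_eq0; move: y12; rewrite -addr_eq0 => y12.
  rewrite -(mulIr_eq0 _ (mulIf y12)) -subr_sqr.
  by rewrite (@curve_eq x1 y1 (Point h1)) // (@curve_eq x1 y2 (Point h2)) // subrr.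
have d : x2 - x1 != 0 by rewrite subr_eq0 eq_sym.
have d' : x1 - x2 != 0 by rewrite subr_eq0.
by congr Some; congr pair; field; rewrite ?d ?d'.
Qed.

Lemma addpN P : addp P (oppp P) = point0.
Proof.
apply: val_inj; case: P => -[[x y]|] h //=.
by rewrite eqxx /= opprK eqxx.
Qed.

Lemma addp_eq0 P Q : addp P Q = point0 -> Q = oppp P.
Proof.
move=> /(congr1 (@point_val E F)); case: P => -[[x1 y1]|] h1; case: Q => -[[x2 y2]|] h2 //= e;
  apply: val_inj => //=; move: e.
case: ifP => // /negbFE/eqP ->; case: ifP => // /eqP -> _.
by rewrite opprK.
Qed.

Lemma mem_prod_neutral P L f : point_val P = None -> mem_prod L f -> mem_prod (P :: L) f.
Proof. by move=> e Lf; rewrite -[f]mul1r; apply: mem_cons; rewrite ?e. Qed.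

Lemma pointP P : P = point0 \/ exists x y, point_val P = Some (x, y).
Proof.
case e: (point_val P) => [[x y]|]; first by right; exists x, y.
by left; apply: val_inj; exact: e.
Qed.

(** [ell] is the chord or the tangent, or a vertical line when P, Q or P + Q is at infinity. The
    norm only records abscissas, and the sum shares its abscissa with its opposite. *)
Lemma line_ex P Q : exists ell, mem_prod [:: P; Q; oppp (addp P Q)] ell /\
  exists2 c, c != 0 & normc ell = c%:P * (xfun P * xfun Q * xfun (addp P Q)).
Proof.
have vert (R : pt) : exists2 c : F, c != 0 & normc (cst w (xfun R)) = c%:P * (xfun R * xfun R).
  by exists 1; rewrite ?oner_neq0 // normc_cst mul1r expr2.
have [->|[x1 [y1 eP]]] := pointP P.
  rewrite add0p; exists (cst w (xfun Q)); split; last by rewrite mul1r; apply: vert.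
  by apply: mem_prod_neutral => //; apply: mem_prod_vertical.
have [->|[x2 [y2 eQ]]] := pointP Q.
  rewrite addp0; exists (cst w (xfun P)); split; last by rewrite mulr1; apply: vert.
  by apply: mem_prod_swap; apply: mem_prod_neutral => //; apply: mem_prod_vertical.
have [e0|ne0] := eqVneq (addp P Q) point0.
  have -> := addp_eq0 e0; rewrite addpN oppp0; exists (cst w (xfun P)); split.
    rewrite -[[:: _; _; _]]/([:: P; oppp P] ++ [:: point0]) -[X in mem_prod _ X]mulr1.
    apply: mem_prod_cat; first exact: mem_prod_vertical.
    by apply: mem_prod_neutral => //; apply: mem_nil.
  by rewrite xfun_opp /= mulr1.
(* From here on chord and tangent are treated alike: a slope l with the relations required by
   [cubic_line]. *)
have [l [eS hy h1]] : exists l, [/\ point_val (addp P Q) = add_slope l x1 y1 x2,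
    y2 = l * (x2 - x1) + y1 &
    a - 2 * l * (y1 - l * x1) = x1 * x2 + (x1 + x2) * (l ^+ 2 - x1 - x2)].
  have c1 := curve_eq eP; have c2 := curve_eq eQ.
  move: ne0; rewrite -val_eqE /= eP eQ /=; rewrite !horner_cubic in c1 c2.
  case: ifP => [x12|/negbFE/eqP x12].
    have d : x2 - x1 != 0 by rewrite subr_eq0 eq_sym.
    exists ((y2 - y1) / (x2 - x1)); split => //; first by rewrite divfK ?subrK.
    have -> : a = (y2 ^+ 2 - y1 ^+ 2 - x2 ^+ 3 + x1 ^+ 3) / (x2 - x1).
      by rewrite c1 c2; field.
    by field.
  subst x2; case: ifP => // /negbT; rewrite -addr_eq0 => y0 _.
  have y12 : y1 = y2.
    apply/eqP; rewrite -subr_eq0 -(mulIr_eq0 _ (mulIf y0)) -subr_sqr c1 c2.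
    by rewrite subrr.
  have d : 2 * y1 != 0 by move: y0; rewrite -y12 -mulr2n mulr_natl.
  exists ((3 * x1 ^+ 2 + a) / (2 * y1)); split => //; first by rewrite subrr mulr0 add0r.
  by field; rewrite -mulr_natl in d *; move: d; rewrite mulf_eq0 negb_or => /andP[].
set x3 := l ^+ 2 - x1 - x2 in h1.
have h2 : l ^+ 2 = x1 + x2 + x3 by rewrite /x3; ring.
have h0 : b - (y1 - l * x1) ^+ 2 = - (x1 * x2 * x3).
  have := curve_eq eP; rewrite horner_cubic => /eqP; rewrite eq_sym -subr_eq0 => /eqP c1.
  apply/eqP; rewrite -subr_eq0 -c1; apply/eqP.
  have -> : a = x1 * x2 + (x1 + x2) * x3 + 2 * l * (y1 - l * x1) by rewrite -h1 subrK.
  by rewrite /x3; ring.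
have [fac _] := cubic_line h2 h1 h0.
have ev z : (l%:P * 'X + (y1 - l * x1)%:P).[z] = l * (z - x1) + y1.
  by rewrite hornerD hornerM !hornerC hornerX; ring.
exists (- (l%:P * 'X + (y1 - l * x1)%:P), 1); split.
  apply: (@mem_prod_line _ _ _ x1 x2 x3) => //.
  - by rewrite eP ev subrr mulr0 add0r.
  - by rewrite eQ ev -hy.
  - rewrite /= -[add_raw _ _ _]/(point_val (addp P Q)) eS ev /= -/x3.
    by have -> : - (l * (x1 - x3) - y1) = l * (x3 - x1) + y1 by ring.
exists (- 1); first by rewrite oppr_eq0 oner_eq0.
rewrite eP eQ eS /= -fac /normc /= polyCN; ring.
Qed.

(** This is 2 y times the derivative of f along the curve, as 2 y dy/dx = 3 x ^ 2 + a; the factor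
    avoids a division by y. *)
Definition tangent_deriv (x y : F) (f : C) : F :=
  2 * y * (f.1^`().[x] + y * f.2^`().[x]) + f.2.[x] * (3 * x ^+ 2 + a).

Lemma mem_prod_double P x y f :
  point_val P = Some (x, y) -> mem_prod [:: P; P] f -> tangent_deriv x y f = 0.
Proof.
move=> eP; apply: (@mem_prod_consE _ _ _ (fun f => tangent_deriv x y f = 0)).
  move=> g h vg /vanish_mem_prod vh; move: vg vh; rewrite eP /= => vg vh.
  have ew : w.[x] = y ^+ 2 by rewrite (curve_eq eP).
  have dw : w^`().[x] = 3 * x ^+ 2 + a.
    rewrite /cubic !derivD derivM derivXn !derivC derivX.
    by rewrite mul0r addr0 mulr1 add0r hornerD hornerMn hornerXn hornerC -mulr_natl.
  rewrite /tangent_deriv /= !derivD !derivM !hornerD !hornerM ew.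
  rewrite [(_ * _ + _ * _).[x]]hornerD !hornerM ew dw.
  transitivity ((g.1.[x] + y * g.2.[x]) * tangent_deriv x y h
      + (h.1.[x] + y * h.2.[x]) * tangent_deriv x y g); last by rewrite vg vh; ring.
  by rewrite /tangent_deriv; ring.
move=> g h /= eg eh; transitivity (tangent_deriv x y g + tangent_deriv x y h).
  by rewrite /tangent_deriv /= !derivD !hornerD; ring.
by rewrite eg eh addr0.
Qed.

Lemma size_cubic : size w = 4%N.
Proof.
rewrite /cubic -addrA size_polyDl size_polyXn //.
apply: leq_ltn_trans (size_polyD _ _) _; rewrite gtn_max.
apply/andP; split; last by apply: leq_ltn_trans (size_polyC_leq1 _) _.
by rewrite mul_polyC; apply: leq_ltn_trans (size_scale_leq _ _) _; rewrite size_polyX.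
Qed.

Lemma size_sqr_poly (p : {poly F}) : p != 0 -> size (p ^+ 2) = (size p).*2.-1.
Proof. by move=> p0; rewrite expr2 size_mul // addnn. Qed.

(** The degrees of f.1 ^ 2 and w f.2 ^ 2 have opposite parities, so nothing cancels in the norm, and
    the second is at least 3 unless f.2 = 0. *)
Lemma normc_size_le3 f : (size (normc f) <= 3)%N -> f.2 = 0.
Proof.
move=> sf; apply/eqP; apply: contraLR sf => f20; rewrite -ltnNge.
have f2s : (0 < size f.2)%N by rewrite lt0n size_poly_eq0.
have s2 : size (w * f.2 ^+ 2) = (size f.2).*2.+2.
  have w0 : w != 0 by rewrite -size_poly_eq0 size_cubic.
  by rewrite size_mul ?expf_neq0 // size_cubic size_sqr_poly //; case: (size f.2) f2s.
rewrite /normc.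
have [->|f10] := eqVneq f.1 0.
  by rewrite expr0n sub0r size_polyN s2; move: f2s; lia.
have s1 := size_sqr_poly f10.
have f1s : (0 < size f.1)%N by rewrite lt0n size_poly_eq0.
have [lt|ge] := ltnP (size (f.1 ^+ 2)) (size (w * f.2 ^+ 2)).
  by rewrite addrC size_polyDl size_polyN ?s2 //; move: f2s; lia.
rewrite size_polyDl ?size_polyN s1 ?s2; move: ge; rewrite s1 s2; lia.
Qed.

Lemma size_xfun P : (size (xfun P) <= 2)%N.
Proof. by case: (point_val P) => [[x y]|] /=; rewrite ?size_XsubC ?size_poly1. Qed.

Lemma xfun_neq0 P : xfun P != 0.
Proof. by case: (point_val P) => [[x y]|] /=; rewrite ?polyXsubC_eq0 ?oner_eq0. Qed.

(** By [normc_size_le3], f is a polynomial in x, so the norm is a square; hence P and Q are both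
    infinite or share their abscissa. The case of distinct opposite points is excluded by a
    multiplicity argument. *)
Lemma mem_prod_eq P Q f c : mem_prod [:: oppp P; Q] f -> c != 0 ->
  normc f = c%:P * (xfun P * xfun Q) -> P = Q.
Proof.
move=> mf c0 nf.
have sz : size (normc f) = size (xfun P * xfun Q) by rewrite nf mul_polyC size_scale.
have f2 : f.2 = 0.
  apply: normc_size_le3; rewrite sz; apply: leq_trans (size_polyMleq _ _) _.
  by have := size_xfun P; have := size_xfun Q; lia.
have f1 : f.1 ^+ 2 = c%:P * (xfun P * xfun Q).
  by rewrite -nf /normc f2 expr0n mulr0 subr0.
have f10 : f.1 != 0.
  rewrite -sqrf_eq0 f1 mulf_neq0 ?polyC_eq0 //.
  by rewrite mulf_neq0 ?xfun_neq0.
(* A nonzero square has odd size, whereas the size would be 2 if exactly one of P, Q were at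
   infinity. *)
have odd_sz : odd (size (xfun P * xfun Q)).
  rewrite -sz /normc f2 expr0n mulr0 subr0 size_sqr_poly //.
  have : (0 < size f.1)%N by rewrite lt0n size_poly_eq0.
  by case: (size f.1) => // k _ /=; rewrite odd_double.
have vP : vanish (oppp P) f := vanish_mem_prod mf.
have vQ : vanish Q f := vanish_mem_prod (mem_prod_swap mf).
move: odd_sz f1 vP vQ => /=; have [eP|[x [y eP]]] := pointP P.
  have [->|[x' [y' eQ]]] := pointP Q; first by rewrite eP.
  by rewrite eP eQ /= mul1r size_XsubC.
have [->|[x' [y' eQ]]] := pointP Q; first by rewrite eP /= mulr1 size_XsubC.
rewrite eP eQ /= f2 !horner0 !mulr0 !addr0 => _ f1 vP vQ.
have /factor_theorem[q eq] : root f.1 x by rewrite rootE vP.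
have fq : q ^+ 2 * ('X - x%:P) = c%:P * ('X - x'%:P).
  apply: (mulIf (_ : 'X - x%:P != 0)); first by rewrite polyXsubC_eq0.
  by rewrite -[RHS]mulrA [X in c%:P * X]mulrC -f1 eq; ring.
have xx' : x = x'.
  have := congr1 (horner^~ x) fq; rewrite !hornerM hornerC !hornerXsubC subrr mulr0.
  by move/esym/eqP; rewrite mulf_eq0 (negPf c0) subr_eq0 => /eqP.
subst x'; have q2 : q ^+ 2 = c%:P by apply: mulIf fq; rewrite polyXsubC_eq0.
have := curve_eq eP; rewrite -(curve_eq eQ) => /eqP; rewrite eqf_sqr.
case/orP => /eqP yy'; first by apply: val_inj; rewrite /= eP eQ yy'.
have [y0|y0] := eqVneq y 0.
  by apply: val_inj; rewrite /= eP eQ; move/eqP: yy'; rewrite y0 eq_sym oppr_eq0 => /eqP ->.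
(* Now Q = - P with y != 0, and f vanishes doubly at Q; but f is a nonzero constant times X - x,
   which has only a simple zero there. *)
have QP : oppp P = Q by apply: val_inj; rewrite /= eP eQ /= yy' opprK.
move: mf; rewrite QP => /(mem_prod_double eQ).
rewrite /tangent_deriv f2 derivC !horner0 mulr0 mul0r !addr0 eq derivM derivXsubC.
rewrite hornerD !hornerM hornerXsubC subrr mulr0 add0r hornerC mulr1 => /eqP.
rewrite mulf_eq0 mulf_eq0 pnatr_eq0 /= -oppr_eq0 -yy' (negPf y0) /= => /eqP q0.
have := congr1 (horner^~ x) q2; rewrite hornerC expr2 hornerM q0 mul0r.
by move=> /esym/eqP; rewrite (negPf c0).
Qed.

Lemma opppK P : oppp (oppp P) = P.
Proof. by apply: val_inj; case: P => -[[x y]|] //= h; rewrite opprK. Qed.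

(* Let S = (P + Q) + R and S' = P + (Q + R). Multiplying the lines used to compute
   S by the conjugates of those used to compute S', and cancelling P, Q, R, P + Q
   and Q + R against their opposites, leaves a function vanishing at - S and S'
   whose norm has degree 2. Such a function is of the form c (x - e), so S = S'. *)
Lemma addpA : associative (@addp E F).
Proof.
move=> P Q R.
have [l1 [m1 [c1 c10 n1]]] := line_ex P Q.
have [l2 [m2 [c2 c20 n2]]] := line_ex (addp P Q) R.
have [l3 [m3 [c3 c30 n3]]] := line_ex Q R.
have [l4 [m4 [c4 c40 n4]]] := line_ex P (addp Q R).
move: (mem_prod_conj m3) (mem_prod_conj m4) => /=; rewrite !opppK => m3' m4'.
move: (mem_prod_cat m1 (mem_prod_cat m2 (mem_prod_cat m3' m4'))) n2 n4 => /=.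
set PQ := addp P Q in n1 *; set QR := addp Q R in n3 *.
set S' := addp P QR; set S := addp PQ R => mf n2 n4.
have {}mf : mem_prod [:: P, oppp P, Q, oppp Q, R, oppp R, PQ, oppp PQ, QR, oppp QR &
    [:: oppp S; S']] (l1 * (l2 * (conjc l3 * conjc l4))).
  by apply: mem_prod_perm mf; apply/permP => p /=; ring.
have [f1 mf1 e1] := mem_prod_cancel mf.
have [f2 mf2 e2] := mem_prod_cancel mf1.
have [f3 mf3 e3] := mem_prod_cancel mf2.
have [f4 mf4 e4] := mem_prod_cancel mf3.
have [f5 mf5 e5] := mem_prod_cancel mf4.
symmetry; apply: (mem_prod_eq mf5 (_ : c1 * c2 * c3 * c4 != 0)).
  by rewrite !mulf_neq0.
have := congr1 (@normc F w) e1; rewrite e2 e3 e4 e5 !normcM !normc_conj n1 n2 n3 n4 !normc_cst.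
set A := xfun P * xfun Q * xfun R * xfun PQ * xfun QR => e.
have A0 : A ^+ 2 != 0 by rewrite expf_neq0 // !mulf_neq0 ?xfun_neq0.
apply: (mulfI A0); transitivity
  (xfun P ^+ 2 * (xfun Q ^+ 2 * (xfun R ^+ 2 * (xfun PQ ^+ 2 * (xfun QR ^+ 2 * normc f5))))).
  by rewrite /A; ring.
by rewrite -e /A; ring.
Qed.

End GroupLaw.

(** * Divisibility of the group of geometric points *)

Definition nonsingular (E : weierstrass) : bool :=
  4 * E.1 ^+ 3 + 27 * E.2 ^+ 2 != 0.

(* An alias of [point] carrying the proof of nonsingularity, on which the group
   structure depends. *)
Definition ec (E : weierstrass) (nsE : nonsingular E) (F : numFieldType) : Type :=
  Defs.point E F.

Section CurveGroup.
Variables (E : weierstrass) (nsE : nonsingular E) (F : numFieldType).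

HB.instance Definition _ := Choice.copy (ec nsE F) (Defs.point E F).

Fact ec_addA : associative (@addp E F : ec nsE F -> ec nsE F -> ec nsE F).
Proof. exact: addpA. Qed.

Fact ec_addC : commutative (@addp E F : ec nsE F -> ec nsE F -> ec nsE F).
Proof. exact: addpC. Qed.

Fact ec_add0 : left_id (point0 : ec nsE F) (@addp E F).
Proof. exact: add0p. Qed.

Fact ec_addN : left_inverse (point0 : ec nsE F) (@oppp E F) (@addp E F).
Proof. by move=> P; rewrite addpC addpN. Qed.

HB.instance Definition _ := GRing.isZmodule.Build (ec nsE F)
  ec_addA ec_addC ec_add0 ec_addN.

Implicit Types P Q : ec nsE F.

Lemma mulpnE P n : mulpn P n = P *+ n.
Proof. by elim: n => //= n IH; rewrite mulrS -IH. Qed.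

Lemma mulpzE P m : Defs.mulpz P m = P *~ m.
Proof. case: m => n; first exact: mulpnE.
exact: (congr1 (@oppp E F) (mulpnE P n.+1)). Qed.

Lemma ec_same_x P Q x y y' : point_val P = Some (x, y) ->
  point_val Q = Some (x, y') -> P = Q \/ P = - Q.
Proof.
move=> eP eQ; have := curve_eq eP; rewrite -(curve_eq eQ) => /eqP.
rewrite eqf_sqr => /orP[]/eqP yy; [left | right]; apply: val_inj.
  by rewrite /= eP eQ yy.
by rewrite [LHS]eP yy -[RHS]/(opp_raw Q) eQ.
Qed.

End CurveGroup.

Section Divisibility.
Variables (E : weierstrass) (nsE : nonsingular E) (F : numClosedFieldType).
Local Notation a := (E.1%:~R : F).
Local Notation b := (E.2%:~R : F).
Local Notation G := (ec nsE F).
Local Notation w := (cubic E F).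

Fact lift_x_subproof (x : F) : on_curve E (Some (x, sqrtC w.[x])).
Proof. by rewrite /= sqrtCK horner_cubic. Qed.

Definition lift_x (x : F) : G := Point (lift_x_subproof x).

Lemma lift_xP (P : G) x y : point_val P = Some (x, y) -> P = lift_x x \/ P = - lift_x x.
Proof. by move=> eP; apply: ec_same_x eP _. Qed.

(** By the duplication formula, q is the numerator of x(2 R) - x0 in terms of x(R). A root r of q
    with w(r) = 0 would satisfy (3 r ^ 2 + a) ^ 2 = 0, against smoothness, so the tangent formula
    applies to the point over r. *)
Lemma ec_halve (P : G) : exists Q : G, P = Q *+ 2.
Proof.
have [->|[x0 [y0 eP]]] := pointP P; first by exists 0; rewrite mul0rn.
pose q : {poly F} := 'X^4 - (2 * a)%:P * 'X^2 - (8 * b)%:P * 'X + (a ^+ 2)%:P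
  - (4 * x0)%:P * w.
have qE r : q.[r] = r ^+ 4 - 2 * a * r ^+ 2 - 8 * b * r + a ^+ 2 - 4 * x0 * w.[r].
  by rewrite /q !(hornerD, hornerN, hornerM, hornerXn, hornerC, hornerX).
have : size q != 1%N.
  apply: contraTneq isT => /eqP/size_poly1P[c _ qc].
  have := congr1 (fun p : {poly F} => p`_4) qc; rewrite coefC /= /q /cubic.
  rewrite !(coefD, coefN, coefCM, coefXn, coefX, coefC) /=.
  by rewrite !(mulr0, addr0, subr0) => /eqP; rewrite oner_eq0.
case/closed_rootP => r; rewrite rootE qE => /eqP qr.
have w0 : w.[r] != 0.
  apply/eqP => wr; have e0 : r ^+ 3 + a * r + b = 0 by rewrite -horner_cubic.
  have := cubic_simple_root nsE e0; rewrite -sqrf_eq0 => /eqP; apply.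
  rewrite -[RHS]qr wr; transitivity (r ^+ 4 - 2 * a * r ^+ 2 - 8 * b * r + a ^+ 2
    + 8 * r * (r ^+ 3 + a * r + b)); last by rewrite e0; ring.
  by ring.
have s0 : sqrtC w.[r] != 0 by rewrite sqrtC_eq0.
pose s := sqrtC w.[r].
have [y eR] : exists y, point_val (lift_x r *+ 2) = Some (x0, y).
  rewrite -[point_val _]/(add_raw E (lift_x r) (lift_x r)) /= eqxx /=.
  have -> : (sqrtC w.[r] == - sqrtC w.[r]) = false.
    by rewrite -addr_eq0 -mulr2n mulrn_eq0 (negPf s0).
  rewrite /add_slope -/s; set x3 := (X in Some (X, _)); eexists.
  suff -> : x3 = x0 by [].
  have s2 : s ^+ 2 = r ^+ 3 + a * r + b by rewrite sqrtCK horner_cubic.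
  rewrite horner_cubic -s2 in qr.
  apply: (mulfI (_ : 4 * s ^+ 2 != 0)); first by rewrite mulf_neq0 ?pnatr_eq0 ?expf_neq0.
  apply/eqP; rewrite -subr_eq0 -qr; apply/eqP.
  transitivity ((3 * r ^+ 2 + a) ^+ 2 - 8 * r * (s ^+ 2) - 4 * s ^+ 2 * x0).
    by rewrite /x3; field.
  by rewrite s2; ring.
have [->|->] := ec_same_x eP eR; first by exists (lift_x r).
by exists (- lift_x r); rewrite mulNrn.
Qed.

Lemma ec_two_torsion : exists2 T : G, T != 0 & T *+ 2 = 0.
Proof.
have /closed_rootP[e] : size w != 1%N by rewrite size_cubic.
rewrite rootE => /eqP we; exists (lift_x e); first by [].
rewrite mulr2n -[X in X + _]opprK.
suff -> : - lift_x e = lift_x e by rewrite addNr.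
by apply: val_inj; rewrite /= we sqrtC0 oppr0.
Qed.

(* Repeated halving of a point of order 2 gives points of unbounded order. *)
Lemma ec_exponent m : (0 < m)%N -> exists P : G, P *+ m != 0.
Proof.
have [T T0 T2] := ec_two_torsion; move=> m0.
suff [P PT] : exists P : G, P *+ m = T by exists P; rewrite PT.
elim/ltn_ind: m m0 => m IH m0; have em := odd_double_half m.
case om: (odd m) em => em.
  exists T; rewrite -em mulrnDr mulr1n -mul2n mulrnA T2 mul0rn addr0 //.
have [|//|P PT] := IH m./2; first by move: em m0; lia.
  by move: em m0; lia.
have [Q QP] := ec_halve P; exists Q.
by rewrite -em add0n -mul2n mulrnA -QP.
Qed.

Definition generic (d : {poly F}) (P : G) : bool :=
  if point_val P is Some (x, y) then d.[x] != 0 else false.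

Lemma generic_cofinite d : d != 0 ->
  exists L : seq G, forall P, ~~ generic d P -> P \in L.
Proof.
move=> d0; have [rs drs] := closed_field_poly_normal d.
exists (0 :: flatten [seq [:: lift_x r; - lift_x r] | r <- rs]) => P.
rewrite /generic; have [->|[x [y eP]]] := pointP P; first by rewrite mem_head.
rewrite eP negbK => dx; rewrite inE; apply/orP; right.
have xr : x \in rs.
  by move: dx; rewrite drs -rootE rootZ ?lead_coef_eq0 // root_prod_XsubC.
apply/flattenP; exists [:: lift_x x; - lift_x x]; first exact: map_f.
by rewrite !inE; case: (lift_xP eP) => ->; rewrite eqxx ?orbT.
Qed.

Lemma generic_exists (L : seq G) d : d != 0 -> exists2 P, generic d P & P \notin L.
Proof.
move=> d0; pose D := d * \prod_(Q <- L) xfun Q.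
have D0 : D != 0 by rewrite mulf_neq0 // prodf_seq_neq0; apply/allP => Q _; apply: xfun_neq0.
have /closed_nonrootP[x] := D0; rewrite rootM negb_or => /andP[dx Lx].
exists (lift_x x) => //; apply: contra Lx => xL.
rewrite (big_rem _ xL) /= rootM; apply/orP; left.
by rewrite rootE hornerXsubC subrr.
Qed.

Lemma generic_translate d (P : G) : d != 0 -> exists2 Q, generic d Q & generic d (P + Q).
Proof.
move=> d0; have [L dL] := generic_cofinite d0.
have [Q dQ QL] := generic_exists [seq R - P | R <- L] d0.
exists Q => //; apply: contraNT QL => /dL PQ.
by apply/mapP; exists (P + Q) => //; rewrite addrC addKr.
Qed.

(** P = (P + Q) - Q, where Q is chosen with both Q and P + Q generic. *)
Lemma generic_subgroup d (H : G -> Prop) : d != 0 ->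
  (forall P Q, H P -> H Q -> H (P - Q)) -> (forall P, generic d P -> H P) ->
  forall P, H P.
Proof.
move=> d0 HB Hd P; have [Q dQ dPQ] := generic_translate P d0.
by rewrite -(addrK Q P); apply: HB; apply: Hd.
Qed.

Lemma generic_annihilated d m : d != 0 -> (0 < m)%N ->
  ~ (forall P : G, generic d P -> P *+ m = 0).
Proof.
move=> d0 m0 H; have [P /eqP] := ec_exponent m0; apply; move: P.
apply: generic_subgroup d0 _ H => P Q hP hQ.
by rewrite mulrnBl hP hQ subr0.
Qed.

Definition mul_formula n (phi gam d : {poly F}) := forall (P : G) x y,
  point_val P = Some (x, y) -> d.[x] != 0 ->
  point_val (P *+ n) = Some (phi.[x] / d.[x], y * gam.[x] / d.[x]).

(** P is added to n P by the chord formula, unless e vanishes identically. In that case n P is P or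
    - P for every generic P, so (n + 1) (n - 1) kills all of them, against [generic_annihilated]; 1
    < n keeps this exponent positive. *)
Lemma mul_formula_step n phi gam d : (1 < n)%N -> d != 0 -> mul_formula n phi gam d ->
  exists phi' gam' d', d' != 0 /\ mul_formula n.+1 phi' gam' d'.
Proof.
move=> n1 d0 Hn; pose e := phi - 'X * d.
have e0 : e != 0.
  apply/eqP => e0; apply: (@generic_annihilated d (n.+1 * n.-1)) => // [|P].
    by rewrite muln_gt0 /=; lia.
  rewrite /generic; case eP: (point_val P) => [[x y]|] // dx.
  have := Hn P x y eP dx.
  have -> : phi.[x] / d.[x] = x.
    have -> : phi = 'X * d by apply/eqP; rewrite -subr_eq0 -/e e0.
    by rewrite hornerM hornerX mulfK.
  move=> enP; case: (ec_same_x eP enP) => eP'.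
    have P0 : P *+ n.-1 = 0.
      by apply: (addrI P); rewrite addr0 -mulrS prednK -?eP' // ltnW.
    by rewrite mulnC mulrnA P0 mul0rn.
  by rewrite mulrnA mulrS {1}eP' addNr mul0rn.
(* The slope is y u / e, whence x(P + n P) = phi0 / D0; the extra factor e comes from the
   denominator of the y-coordinate. *)
pose u := gam - d; pose D0 := d * e ^+ 2.
pose phi0 := w * u ^+ 2 * d - 'X * D0 - phi * e ^+ 2.
exists (phi0 * e), (u * ('X * D0 - phi0) - e * D0), (D0 * e).
split; first by rewrite !mulf_neq0 ?expf_neq0.
move=> P x y eP; rewrite hornerM mulf_eq0 negb_or => /andP[D0x ex].
have dx : d.[x] != 0 by move: D0x; rewrite hornerM mulf_eq0 negb_or => /andP[].
have enP := Hn P x y eP dx.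
rewrite mulrS -[point_val _]/(add_raw E P (P *+ n)) eP enP /=.
have eE : e.[x] = phi.[x] - x * d.[x] by rewrite hornerD hornerN hornerM hornerX.
have D0E : D0.[x] = d.[x] * (phi.[x] - x * d.[x]) ^+ 2.
  by rewrite hornerM horner_exp eE.
have uE : u.[x] = gam.[x] - d.[x] by rewrite hornerD hornerN.
have phi0E : phi0.[x] = y ^+ 2 * u.[x] ^+ 2 * d.[x] - x * D0.[x]
    - phi.[x] * (phi.[x] - x * d.[x]) ^+ 2.
  rewrite /phi0 (curve_eq eP) -eE; clearbody e u D0.
  move: (cubic E F) => W.
  by rewrite !(hornerD, hornerN, hornerM, horner_exp, hornerX).
clearbody phi0 D0 u e; rewrite !(hornerD, hornerN, hornerM, hornerX).
rewrite phi0E D0E uE eE; rewrite eE in ex.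
move: (phi.[x]) (gam.[x]) (d.[x]) dx ex => p g D dx ex.
have -> : x != p / D by apply: contraNneq ex => ->; rewrite divfK // subrr.
rewrite /add_slope; set x3 := (X in Some (X, _)); set y3 := (X in Some (_, X)).
set x3' := (X in _ = Some (X, _)); set y3' := (X in _ = Some (_, X)).
have ex' : p - D * x != 0 by rewrite mulrC.
have -> : x3 = x3' by rewrite /x3 /x3'; field; rewrite ?dx ?ex ?ex'.
suff -> : y3 = y3' by [].
by rewrite /y3 /x3 /y3'; field; rewrite ?dx ?ex ?ex'.
Qed.

Lemma mul_formula_double : exists phi gam d, d != 0 /\ mul_formula 2 phi gam d.
Proof.
(* x(2 P) = q / (4 w), and 8 w ^ 2 is the denominator of y(2 P) / y(P). *)
pose q : {poly F} := (3%:P * 'X^2 + a%:P) ^+ 2 - 8%:P * 'X * w.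
exists (2%:P * w * q), ((3%:P * 'X^2 + a%:P) * (4%:P * w * 'X - q) - 8%:P * w ^+ 2),
  (8%:P * w ^+ 2).
have w0 : w != 0 by rewrite -size_poly_eq0 size_cubic.
split; first by rewrite mulf_neq0 ?expf_neq0 // polyC_eq0 pnatr_eq0.
move=> P x y eP.
have ew := curve_eq eP; rewrite /q; move: (cubic E F) ew => W ew.
rewrite !(hornerD, hornerN, hornerM, horner_exp, hornerX, hornerC) -ew => w2.
have y0 : y != 0 by apply: contraNneq w2 => ->; rewrite expr0n !mulr0.
rewrite mulr2n -[point_val _]/(add_raw E P P) eP /= eqxx /=.
rewrite -addr_eq0 -mulr2n mulrn_eq0 (negPf y0) /= /add_slope.
set x3 := (X in Some (X, _)); set y3 := (X in Some (_, X)).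
set x3' := (X in _ = Some (X, _)); set y3' := (X in _ = Some (_, X)).
have -> : x3 = x3' by rewrite /x3 /x3'; field.
suff -> : y3 = y3' by [].
by rewrite /y3 /x3 /y3'; field.
Qed.

Lemma mul_formula_exists n : (0 < n)%N ->
  exists phi gam d, d != 0 /\ mul_formula n phi gam d.
Proof.
case: n => [|[|n]] // _.
  exists 'X, 1, 1; split=> [|P x y eP]; first exact: oner_neq0.
  by rewrite hornerX hornerC !divr1 mulr1.
elim: n => [|n [phi [gam [d [d0 Hn]]]]]; first exact: mul_formula_double.
exact: mul_formula_step Hn.
Qed.

(** If x(n P) were constantly k at generic points, differences of generic points would leave only 0,
    Z and - Z as multiples n P, with Z twice a point over k. Such multiples are killed by 6, against
    [ec_exponent]. *)
Lemma mul_formula_nonconstant n phi gam d k : (0 < n)%N -> d != 0 ->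
  mul_formula n phi gam d ->
  ~ (forall x, d.[x] != 0 -> phi.[x] / d.[x] = k).
Proof.
move=> n0 d0 Hn phik; pose Z := lift_x k *+ 2.
have gen P : generic d P -> P *+ n = lift_x k \/ P *+ n = - lift_x k.
  rewrite /generic; case eP: (point_val P) => [[x y]|] // dx.
  by have := Hn P x y eP dx; rewrite phik //; apply: lift_xP.
have S P : [\/ P *+ n = 0, P *+ n = Z | P *+ n = - Z].
  have [Q dQ dPQ] := generic_translate P d0.
  rewrite -(addrK Q P) mulrnBl /Z mulr2n.
  case: (gen _ dQ) (gen _ dPQ) => -> [] ->.
  - by apply: Or31; rewrite subrr.
  - by apply: Or33; rewrite opprD.
  - by apply: Or32; rewrite opprK.
  - by apply: Or31; rewrite subrr.
have n6 : (0 < n * 6)%N by rewrite muln_gt0 n0.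
have [P /eqP] := ec_exponent n6; apply; rewrite mulrnA; set V := P *+ n.
suff : [\/ V = 0, V *+ 2 = 0 | V *+ 3 = 0].
  case=> V0; first by rewrite V0 mul0rn.
  - by rewrite (mulrnA V 2 3) V0 mul0rn.
  - by rewrite (mulrnA V 3 2) V0 mul0rn.
have S2 : [\/ V *+ 2 = 0, V *+ 2 = Z | V *+ 2 = - Z].
  by rewrite -mulrnA mulnC mulrnA; apply: S.
have [V0|VZ|VZ] := S P; first exact: Or31.
- move: S2; rewrite -VZ -/V => -[?|/eqP|e]; first exact: Or32.
    by rewrite mulr2n -subr_eq0 addrK => /eqP; apply: Or31.
  by apply: Or33; rewrite mulrS e subrr.
- have VN : Z = - V by rewrite /V VZ opprK.
  move: S2; rewrite VN opprK => -[?|e|/eqP]; first exact: Or32.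
    by apply: Or33; rewrite mulrS e subrr.
  by rewrite mulr2n -subr_eq0 addrK => /eqP; apply: Or31.
Qed.

Lemma linear_poly_neq0 (c c' : F) : (c != 0) || (c' != 0) -> c%:P - 'X * c'%:P != 0.
Proof.
apply: contraTneq => e; rewrite negb_or !negbK.
have := congr1 (fun p : {poly F} => p`_0) e; have := congr1 (fun p : {poly F} => p`_1) e.
rewrite !coefB !coefXM !coefC /= subr0 sub0r => /eqP; rewrite oppr_eq0 => ->.
by move=> ->; rewrite eqxx.
Qed.

(* x(nP) is a nonconstant function phi / d of x(P), so it takes all but finitely
   many values; the image of multiplication by n is then a subgroup which
   contains all but finitely many points. *)
Lemma ec_divisible n (P : G) : (0 < n)%N -> exists Q : G, Q *+ n = P.
Proof.
move=> n0; have [phi [gam [d [d0 Hn]]]] := mul_formula_exists n0.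
pose g := gcdp phi d; pose p1 := phi %/ g; pose d1 := d %/ g.
have g0 : g != 0 by rewrite gcdp_eq0 negb_and d0 orbT.
have ephi : phi = p1 * g by rewrite divpK // dvdp_gcdl.
have ed : d = d1 * g by rewrite divpK // dvdp_gcdr.
have cop : coprimep p1 d1 by apply: coprimep_div_gcd; rewrite d0 orbT.
(* The reduced fraction p1 / d1 is nonconstant, so some coefficient of positive degree k is
   nonzero. *)
have [k k0 ck] : exists2 k, (0 < k)%N & (p1`_k != 0) || (d1`_k != 0).
  case: (ltnP 1 (size p1)) => [s1|s1].
    exists (size p1).-1; first by move: s1; case: (size p1) => [|[]].
    by rewrite -lead_coefE lead_coef_eq0 -size_poly_eq0; move: s1; case: (size p1).
  case: (ltnP 1 (size d1)) => [s2|s2].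
    exists (size d1).-1; first by move: s2; case: (size d1) => [|[]].
    rewrite -[d1`__]lead_coefE lead_coef_eq0 -[d1 == 0]size_poly_eq0 orbC.
    by move: s2; case: (size d1).
  case: (mul_formula_nonconstant n0 d0 Hn (k := p1`_0 / d1`_0)) => x.
  rewrite ephi ed !hornerM (size1_polyC s1) (size1_polyC s2) !hornerC !coefC /= => dx.
  by move: dx; rewrite mulf_eq0 negb_or => /andP[dx gx]; rewrite -mulf_div divff ?mulr1.
have [rs ers] := closed_field_poly_normal g.
pose lin (c c' : F) : {poly F} := c%:P - 'X * c'%:P.
have linE c c' x : (lin c c').[x] = c - x * c'.
  by rewrite hornerD hornerN hornerM !hornerC hornerX.
pose D := lin p1`_k d1`_k * \prod_(r <- rs) lin p1.[r] d1.[r].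
have D0 : D != 0.
  rewrite mulf_neq0 ?linear_poly_neq0 // prodf_seq_neq0; apply/allP => r _ /=.
  apply: linear_poly_neq0; rewrite -negb_and; apply/andP => -[p1r d1r].
  by have := coprimep_root cop p1r; rewrite d1r.
apply: (generic_subgroup D0 (H := fun P => exists Q, Q *+ n = P)) => {P} [_ _ [P <-] [Q <-]|P].
  by exists (P - Q); rewrite mulrnBl.
rewrite /generic; case eP: (point_val P) => [[x0 y0]|] //.
rewrite hornerM mulf_eq0 negb_or linE => /andP[ck0 Dx].
have /closed_rootP[r] : size (p1 - x0%:P * d1) != 1%N.
  apply: contraNneq ck0 => /eqP/size_poly1P[c _ pc].
  have := congr1 (fun p : {poly F} => p`_k) pc.
  by rewrite coefB coefCM coefC -(prednK k0) /= => ->.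
rewrite rootE hornerD hornerN hornerM hornerC subr_eq0 => /eqP p1r.
have d1r : d1.[r] != 0.
  apply/negP => d1r; have : root p1 r by rewrite rootE p1r (eqP d1r) mulr0.
  by move/(coprimep_root cop); rewrite d1r.
have gr : g.[r] != 0.
  apply: contraNneq Dx => /eqP; rewrite ers hornerZ mulf_eq0 lead_coef_eq0 (negPf g0) /=.
  rewrite -rootE root_prod_XsubC => r_rs; rewrite (big_rem _ r_rs) /= hornerM.
  by rewrite linE p1r subrr mul0r.
have dr : d.[r] != 0 by rewrite ed hornerM mulf_neq0.
have := Hn (lift_x r) r _ erefl dr.
have -> : phi.[r] / d.[r] = x0.
  by rewrite ephi ed !hornerM p1r -mulf_div divff // mulr1 mulfK.
move=> /(ec_same_x eP)[->|->]; first by exists (lift_x r).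
by exists (- lift_x r); rewrite mulNrn.
Qed.

End Divisibility.

(** * Canonical heights and reduced pairs *)

Lemma small_eq0 (R : realType) (x M : R) :
  (forall k : nat, `|x| <= M / 4 ^+ k) -> x = 0.
Proof.
move=> xM; apply/eqP; apply: contraT; rewrite -normr_gt0 => x0.
have [k Mk] : exists k : nat, M / `|x| < k%:R.
  by exists (Num.trunc (M / `|x|)).+1; rewrite truncnS_gt.
have := xM k; rewrite ler_pdivlMr ?exprn_gt0 // => le_xM.
move: Mk; rewrite ltr_pdivrMr // => /(le_lt_trans le_xM).
rewrite mulrC ltr_pM2r // -natrX ltr_nat.
by rewrite ltnNge ltnW // ltn_expl.
Qed.

(** * The canonical height of an almost quadratic function *)

Section CanonicalHeight.
Variables (R : realType) (G : zmodType) (h : G -> R) (K : R).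
Hypothesis h_ge0 : forall P, 0 <= h P.
Hypothesis h_upper : forall P Q, h (P + Q) + h (P - Q) <= 2 * h P + 2 * h Q + K.
Hypothesis h_double : forall P, 4 * h P <= h (P *+ 2) + K.

(** The lower bound comes from [h_upper] at P + Q and P - Q: it bounds h (2 P) + h (2 Q) from above,
    while [h_double] bounds this sum from below by 4 h P + 4 h Q - 2 K. *)
Lemma h_parallelogram P Q :
  `|h (P + Q) + h (P - Q) - 2 * h P - 2 * h Q| <= 2 * `|K|.
Proof.
have := h_upper P Q; have := h_upper (P + Q) (P - Q).
rewrite addrACA subrr addr0 opprD opprK addrACA subrr add0r -!mulr2n.
have := h_double P; have := h_double Q; have := ler_norm K.
rewrite ler_norml => *; apply/andP; split; lra.
Qed.

(** 3 c bounds the defect in h (2 P) = 4 h P, the term h 0 being h (P - P); the division by 3 sums a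
    geometric series of ratio 1 / 4. *)
Let c := (2 * `|K| + h 0) / 3.
Let u P k := h (P *+ (2 ^ k)) / 4 ^+ k.

Lemma u_step P k : `|u P k.+1 - u P k| <= 3 * c / 4 ^+ k.+1.
Proof.
have p4 : 0 < 4 ^+ k :> R by rewrite exprn_gt0.
have -> : u P k.+1 - u P k
    = (h (P *+ (2 ^ k) *+ 2) - 4 * h (P *+ (2 ^ k))) / 4 ^+ k.+1.
  by rewrite /u expnSr mulrnA exprS; field; rewrite ?gt_eqF.
rewrite normrM normfV [X in _ / X]ger0_norm ?exprn_ge0 //.
rewrite ler_pM2r ?invr_gt0 ?exprn_gt0 //; have -> : 3 * c = 2 * `|K| + h 0 by rewrite /c; lra.
have := h_parallelogram (P *+ (2 ^ k)) (P *+ (2 ^ k)); rewrite -mulr2n subrr.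
by have := h_ge0 0; rewrite !ler_norml => *; apply/andP; split; lra.
Qed.

Lemma u_lower_upper P j k : u P j - c / 4 ^+ j <= u P k + c / 4 ^+ k.
Proof.
have stepE i : 3 * c / 4 ^+ i.+1 = c / 4 ^+ i - c / 4 ^+ i.+1.
  by rewrite exprS; field; rewrite expf_neq0.
have mono_lo i : u P i - c / 4 ^+ i <= u P i.+1 - c / 4 ^+ i.+1.
  by have := u_step P i; rewrite stepE ler_norml => *; lra.
have mono_hi i : u P i.+1 + c / 4 ^+ i.+1 <= u P i + c / 4 ^+ i.
  by have := u_step P i; rewrite stepE ler_norml => *; lra.
have c0 : 0 <= c by rewrite divr_ge0 // addr_ge0 // mulr_ge0.
have cc i : 0 <= c / 4 ^+ i by rewrite divr_ge0 // exprn_ge0.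
have lo i m : u P i - c / 4 ^+ i <= u P (i + m)%N - c / 4 ^+ (i + m).
  by elim: m => [|m IH]; rewrite ?addn0 // addnS; apply: le_trans IH _.
have hi i m : u P (i + m)%N + c / 4 ^+ (i + m) <= u P i + c / 4 ^+ i.
  by elim: m => [|m IH]; rewrite ?addn0 // addnS; apply: le_trans IH.
have [jk|/ltnW kj] := leqP j k.
  by have := lo j (k - j)%N; rewrite subnKC // => *; have := cc k; lra.
by have := hi k (j - k)%N; rewrite subnKC // => *; have := cc j; lra.
Qed.

(* The limit of h (2 ^ k P) / 4 ^ k, as the supremum of a nondecreasing sequence. *)
Definition canonical_height P : R := sup (range (fun k => u P k - c / 4 ^+ k)).
Local Notation hh := canonical_height.

(** The case k = 0 compares with h itself; large k carry the parallelogram law to the limit exactly,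
    its defect being divided by 4 ^ k. *)
Lemma canonical_heightP P k : `|hh P - u P k| <= c / 4 ^+ k.
Proof.
have ub k' : ubound (range (fun k => u P k - c / 4 ^+ k)) (u P k' + c / 4 ^+ k').
  by move=> _ [j _ <-]; apply: u_lower_upper.
rewrite ler_norml; apply/andP; split.
  suff : u P k - c / 4 ^+ k <= hh P by lra.
  by apply: ub_le_sup; [exists (u P 0 + c / 4 ^+ 0); apply: ub | exists k].
suff : hh P <= u P k + c / 4 ^+ k by lra.
by apply: sup_le_ub; [exists (u P 0 - c / 4 ^+ 0); exists 0%N | apply: ub].
Qed.

Lemma canonical_height_parallelogram P Q :
  hh (P + Q) + hh (P - Q) = 2 * hh P + 2 * hh Q.
Proof.
apply/eqP; rewrite -subr_eq0; apply/eqP.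
apply: (@small_eq0 _ _ (2 * `|K| + 6 * c)) => k.
have : `|u (P + Q) k + u (P - Q) k - 2 * u P k - 2 * u Q k| <= 2 * `|K| / 4 ^+ k.
  have -> : u (P + Q) k + u (P - Q) k - 2 * u P k - 2 * u Q k
      = (h (P *+ (2 ^ k) + Q *+ (2 ^ k)) + h (P *+ (2 ^ k) - Q *+ (2 ^ k))
         - 2 * h (P *+ (2 ^ k)) - 2 * h (Q *+ (2 ^ k))) / 4 ^+ k.
    by rewrite /u mulrnDl mulrnBl; ring.
  rewrite normrM normfV [X in _ / X]ger0_norm ?exprn_ge0 //.
  by rewrite ler_pM2r ?invr_gt0 ?exprn_gt0 // h_parallelogram.
have := canonical_heightP (P + Q) k; have := canonical_heightP (P - Q) k.
have := canonical_heightP P k; have := canonical_heightP Q k.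
by rewrite !ler_norml => *; rewrite mulrDl; apply/andP; split; lra.
Qed.

Lemma canonical_height_ge0 P : 0 <= hh P.
Proof.
rewrite leNgt; apply/negP => lt0; suff hP : hh P = 0 by rewrite hP ltxx in lt0.
apply: (@small_eq0 _ _ c) => k; apply: le_trans (canonical_heightP P k).
have u0 : 0 <= u P k by rewrite divr_ge0 // exprn_ge0.
by rewrite !ler0_norm; lra.
Qed.

Lemma canonical_height_bound P : `|hh P - h P| <= c.
Proof. by have := canonical_heightP P 0; rewrite /u mulr1n expr0 !divr1. Qed.

End CanonicalHeight.

(** * Shortest vectors for a quadratic function with finite balls *)

Definition indep (G : zmodType) (P Q : G) :=
  forall a b : int, P *~ a + Q *~ b = 0 -> a = 0 /\ b = 0.

Lemma centered_residue (a : int) (n : nat) : (0 < n)%N ->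
  exists a' r : int, a = a' * n%:Z + r /\ `|2 * r| <= n%:Z.
Proof.
move=> n0; have r0 : 0 <= (a %% n)%Z by apply: modz_ge0; lia.
have rn : (a %% n)%Z < n%:Z by apply: ltz_pmod; lia.
have e := divz_eq a n; have [le|gt] := lerP (2 * (a %% n)%Z) n%:Z.
  by exists (a %/ n)%Z, (a %% n)%Z; split=> //; lia.
by exists ((a %/ n)%Z + 1), ((a %% n)%Z - n%:Z); split; lia.
Qed.

Section QuadraticLattice.
Variables (R : realType) (G : zmodType) (q : G -> R).
Hypothesis q_parallelogram : forall P Q, q (P + Q) + q (P - Q) = 2 * q P + 2 * q Q.
Hypothesis q_ge0 : forall P, 0 <= q P.
Hypothesis q_northcott : forall M : R, exists L : seq G, forall P, q P <= M -> P \in L.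

Implicit Types P Q : G.

Let q0 : q 0 = 0.
Proof. by have := q_parallelogram 0 0; rewrite addr0 subr0; lra. Qed.

Definition bilin P Q : R := q (P + Q) - q P - q Q.

Lemma bilinC P Q : bilin P Q = bilin Q P.
Proof. by rewrite /bilin (addrC P) addrAC. Qed.

(** The Jordan-von Neumann argument: a linear combination of four instances of the parallelogram
    law. *)
Lemma bilinDr P Q Q' : bilin P (Q + Q') = bilin P Q + bilin P Q'.
Proof.
rewrite /bilin; have := q_parallelogram (P + Q) Q'.
have := q_parallelogram P (Q - Q'); have := q_parallelogram (P + Q') Q.
have := q_parallelogram Q Q'.
rewrite opprB !addrA (addrAC P Q' Q) (addrAC P Q' (- Q)).
lra.
Qed.

Lemma bilin_muln P Q m : bilin P (Q *+ m) = m%:R * bilin P Q.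
Proof.
elim: m => [|m IH]; first by rewrite mulr0n /bilin addr0 q0; lra.
by rewrite mulrS bilinDr IH -natr1; lra.
Qed.

Lemma bilinNr P Q : bilin P (- Q) = - bilin P Q.
Proof.
have := bilinDr P Q (- Q); rewrite subrr {1}/bilin addr0 q0; lra.
Qed.

Lemma bilin_mulz P Q m : bilin P (Q *~ m) = m%:~R * bilin P Q.
Proof.
case: m => m; first exact: bilin_muln.
by rewrite NegzE !mulrNz bilinNr -pmulrn bilin_muln -pmulrn; lra.
Qed.

Lemma bilin_diag P : bilin P P = 2 * q P.
Proof. by have := q_parallelogram P P; rewrite subrr q0 /bilin; lra. Qed.

Lemma q_mulz P m : q (P *~ m) = m%:~R ^+ 2 * q P.
Proof.
have := bilin_diag (P *~ m); rewrite bilin_mulz bilinC bilin_mulz bilin_diag.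
by move=> e; lra.
Qed.

Lemma q_comb P Q a b : q (P *~ a + Q *~ b) =
  a%:~R ^+ 2 * q P + b%:~R ^+ 2 * q Q + a%:~R * b%:~R * bilin P Q.
Proof.
have : bilin (P *~ a) (Q *~ b) = a%:~R * b%:~R * bilin P Q.
  by rewrite bilin_mulz bilinC bilin_mulz bilinC; lra.
by rewrite /bilin !q_mulz; lra.
Qed.

(** All multiples of P have q = 0, hence lie in a finite list, and two of them coincide. *)
Lemma q_eq0_torsion P : q P = 0 -> exists2 m : nat, (0 < m)%N & P *+ m = 0.
Proof.
move=> qP; have [L HL] := q_northcott 0.
have inL m : P *+ m \in L.
  by apply: HL; rewrite pmulrn q_mulz qP mulr0.
have /(uniqPn 0)[i [j []]] : ~~ uniq [seq P *+ m | m <- iota 0 (size L).+1].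
  apply/negP => /uniq_leq_size -/(_ L).
  rewrite size_map size_iota ltnn => H; suff : false by [].
  by apply: H => _ /mapP[m _ ->].
rewrite size_map size_iota => ij jL.
rewrite !(nth_map 0%N) ?size_iota // ?(ltn_trans ij) // !nth_iota ?(ltn_trans ij) // !add0n.
move=> eP; exists (j - i)%N; first by rewrite subn_gt0.
by rewrite mulrnBr ?(ltnW ij) // -eP subrr.
Qed.

Lemma q_minimal (S : G -> Prop) P0 : S P0 ->
  exists2 Q, S Q & forall P, S P -> q Q <= q P.
Proof.
move=> SP0; have [L HL] := q_northcott (q P0).
suff [Q SQ minQ] : exists2 Q, S Q & forall P, P \in P0 :: L -> S P -> q Q <= q P.
  exists Q => // P SP; have [/HL PL|/ltW P0P] := leP (q P) (q P0).
    by apply: minQ; rewrite ?inE ?PL ?orbT.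
  by apply: le_trans P0P; apply: minQ; rewrite ?mem_head.
elim: L {HL} => [|P L [Q SQ minQ]].
  by exists P0 => // P; rewrite inE => /eqP ->.
have [[SP PQ]|nP] := pselect (S P /\ q P <= q Q).
  exists P => // P'; rewrite !inE => /or3P[/eqP ->|/eqP ->|P'L] SP' //.
    by apply: le_trans PQ (minQ _ _ SP'); rewrite mem_head.
  by apply: le_trans PQ (minQ _ _ SP'); rewrite inE P'L orbT.
exists Q => // P'; rewrite !inE => /or3P[/eqP ->|/eqP ->|P'L] SP'.
- by apply: minQ => //; rewrite mem_head.
- by rewrite leNgt; apply/negP => /ltW PQ; apply: nP; rewrite -?e.
- by apply: minQ => //; rewrite inE P'L orbT.
Qed.

Lemma nontorsion_gt0 P : (forall a : int, P *~ a = 0 -> a = 0) -> 0 < q P.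
Proof.
move=> ntP; rewrite lt_neqAle q_ge0 andbT eq_sym; apply/eqP => /q_eq0_torsion[m m0].
by move=> /(ntP m%:Z) /eqP; rewrite eqz_nat; case: m m0.
Qed.

Lemma gt0_nontorsion P a : 0 < q P -> P *~ a = 0 -> a = 0.
Proof.
move=> qP e; have := q_mulz P a; rewrite e q0 => /esym/eqP.
by rewrite mulf_eq0 (gt_eqF qP) orbF sqrf_eq0 intr_eq0 => /eqP.
Qed.

Lemma indep_nontorsion P Q : indep P Q ->
  (forall a : int, P *~ a = 0 -> a = 0) /\ (forall a : int, Q *~ a = 0 -> a = 0).
Proof.
move=> PQ; split=> a e.
  by have [] := PQ a 0; rewrite ?mulr0z ?addr0.
by have [] := PQ 0 a; rewrite ?mulr0z ?add0r.
Qed.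

(** Were Q dependent on both, a Q = b P1 and c Q = d P2 with nonzero coefficients would give b c P1
    = a d P2. *)
Lemma indep_exchange P1 P2 Q : indep P1 P2 -> (forall a : int, Q *~ a = 0 -> a = 0) ->
  indep Q P1 \/ indep Q P2.
Proof.
move=> P12 ntQ; have [ntP1 ntP2] := indep_nontorsion P12.
have dep P : (forall a : int, P *~ a = 0 -> a = 0) -> ~ indep Q P ->
    exists a b : int, [/\ a != 0, b != 0 & Q *~ a = P *~ b].
  move=> ntP /existsNP[a /existsNP[b /not_implyP[e nab]]].
  exists a, (- b); rewrite oppr_eq0; split.
  - apply/eqP => a0; apply: nab; split=> //; apply: ntP.
    by rewrite -e a0 mulr0z add0r.
  - apply/eqP => b0; apply: nab; split=> //; apply: ntQ.
    by rewrite -e b0 mulr0z addr0.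
  - by rewrite mulrNz; apply/eqP; rewrite -addr_eq0 e.
apply/or_asboolP; rewrite -implyNb; apply/implyP => /asboolPn /(dep _ ntP1).
case=> a [b [a0 b0 e1]]; apply/asboolP; apply: contrapT => /(dep _ ntP2).
case=> c [d [c0 d0 e2]].
have [] := P12 (b * c) (- (d * a)).
  by rewrite mulrNz !mulrzA -e1 -e2 -!mulrzA (mulrC a) subrr.
by move/eqP; rewrite mulf_eq0 (negPf b0) (negPf c0).
Qed.

(* A Minkowski reduced pair: the first vector is a shortest one, the second is a
   shortest one among those independent of the first. *)
Lemma reduced_pair P1 P2 : indep P1 P2 -> exists Q1 Q2 : G,
  forall (n : nat) (a b : int) Q, (0 < n)%N -> Q1 *~ a + Q2 *~ b = Q *+ n ->
    (n %| a)%Z /\ (n %| b)%Z.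
Proof.
move=> P12; have [ntP1 ntP2] := indep_nontorsion P12.
have [Q1 q1 min1] := q_minimal (S := fun P => 0 < q P) (nontorsion_gt0 ntP1).
have ntQ1 a : Q1 *~ a = 0 -> a = 0 by apply: gt0_nontorsion.
have [Q2 ind2 min2] : exists2 Q2, indep Q1 Q2 & forall P, indep Q1 P -> q Q2 <= q P.
  by case: (indep_exchange P12 ntQ1); apply: q_minimal.
have [_ ntQ2] := indep_nontorsion ind2.
have q2 := nontorsion_gt0 ntQ2; have q12 := min1 _ q2.
(* Minimality of Q2 against Q2 + Q1 and Q2 - Q1. *)
have bil : `|bilin Q1 Q2| <= q Q1.
  have shift (e : int) : indep Q1 (Q1 *~ e + Q2).
    move=> a b; rewrite mulrzDl addrA -mulrzA -mulrzDr => /ind2[+ b0].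
    by rewrite b0 mulr0 addr0.
  have := min2 _ (shift 1); have := min2 _ (shift (-1)).
  have := q_comb Q1 Q2 1 1; have := q_comb Q1 Q2 (-1) 1.
  rewrite !mulr1z => -> -> *; rewrite ler_norml; apply/andP; split; lra.
exists Q1, Q2 => n a b Q n0 e.
have [a' [r [ea r2]]] := centered_residue a n0.
have [b' [s [eb s2]]] := centered_residue b n0.
pose Q' := Q - Q1 *~ a' - Q2 *~ b'.
have e' : Q1 *~ r + Q2 *~ s = Q' *+ n.
  rewrite /Q' !mulrnBl -e ea eb !mulrzDr !mulrzA -!pmulrn.
  rewrite (addrC (Q1 *~ a' *+ n)) (addrC (Q2 *~ b' *+ n)) addrACA.
  by rewrite addrA addrAC addrK addrK.
have qe : n%:R ^+ 2 * q Q' = r%:~R ^+ 2 * q Q1 + s%:~R ^+ 2 * q Q2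
    + r%:~R * s%:~R * bilin Q1 Q2.
  by rewrite -q_comb e' pmulrn q_mulz.
have r2R : `|2 * r%:~R| <= n%:R :> R.
  by move: r2; rewrite -(ler_int R) intr_norm rmorphM.
have s2R : `|2 * s%:~R| <= n%:R :> R.
  by move: s2; rewrite -(ler_int R) intr_norm rmorphM.
have nR : 0 < n%:R :> R by rewrite ltr0n.
have rr : 4 * r%:~R ^+ 2 <= n%:R ^+ 2 :> R.
  have := ler_pM (normr_ge0 _) (normr_ge0 _) r2R r2R.
  by rewrite -normrM -expr2 ger0_norm ?sqr_ge0 // => *; lra.
have ss : 4 * s%:~R ^+ 2 <= n%:R ^+ 2 :> R.
  have := ler_pM (normr_ge0 _) (normr_ge0 _) s2R s2R.
  by rewrite -normrM -expr2 ger0_norm ?sqr_ge0 // => *; lra.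
(* If s != 0, then Q' is independent of Q1, but n ^ 2 q Q' <= (n ^ 2 / 4) (2 q Q1 + q Q2) <= (3 / 4)
   n ^ 2 q Q2, against the minimality of Q2. *)
have s0 : s = 0.
  apply/eqP; apply: contraT => s0.
  have ind' : indep Q1 Q'.
    move=> x y exy; have [] := ind2 (x * n%:Z + y * r) (y * s).
      transitivity ((Q1 *~ x + Q' *~ y) *~ n); last by rewrite exy mul0rz.
      rewrite mulrzDl mulrzDr -!mulrzA (mulrC y n%:Z) (mulrC y r) (mulrC y s) !mulrzA.
      by rewrite -[Q' *~ n]pmulrn -e' mulrzDl addrA.
    move=> ex /eqP; rewrite mulf_eq0 (negPf s0) orbF => /eqP y0; move: ex.
    by rewrite y0 mul0r addr0 => /eqP; rewrite mulf_eq0 eqz_nat (gtn_eqF n0) orbF => /eqP ->.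
  have q2' := min2 _ ind'.
  have rs : 4 * (r%:~R * s%:~R * bilin Q1 Q2) <= n%:R ^+ 2 * q Q1.
    apply: le_trans (ler_norm _) _.
    have -> : 4 * (r%:~R * s%:~R * bilin Q1 Q2) = (2 * r%:~R) * (2 * s%:~R) * bilin Q1 Q2.
      by ring.
    rewrite [leLHS]normrM [`|_ * (_ * _)|]normrM expr2.
    by apply: ler_pM => //; apply: ler_pM.
  have n2 : 0 < n%:R ^+ 2 :> R by rewrite exprn_gt0.
  have h1 := ler_wpM2r (q_ge0 Q1) rr; have h2 := ler_wpM2r (q_ge0 Q2) ss.
  have h3 := ler_wpM2l (ltW n2) q12; have h4 := ler_wpM2l (ltW n2) q2'.
  have h5 := mulr_gt0 n2 q2.
  suff : false by [].
  move: qe h1 h2 h3 h4 h5 rs; clear; lra.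
(* With s = 0 and r != 0, 0 < q Q' <= q Q1 / 4, against the minimality of Q1. *)
have r0 : r = 0.
  apply/eqP; apply: contraT => r0; move: qe; rewrite s0 expr0n /= mul0r mulr0 mul0r !addr0 => qe.
  have n2 : 0 < n%:R ^+ 2 :> R by rewrite exprn_gt0.
  have q' : 0 < q Q'.
    rewrite -(pmulr_rgt0 _ n2) qe mulr_gt0 // lt_neqAle sqr_ge0 andbT eq_sym.
    by rewrite sqrf_eq0 intr_eq0.
  have h1 := ler_wpM2r (q_ge0 Q1) rr; have h2 := ler_wpM2l (ltW n2) (min1 _ q').
  have h3 := mulr_gt0 n2 q1.
  suff : false by [].
  move: qe h1 h2 h3; clear; lra.
by rewrite ea eb r0 s0 !addr0 !dvdz_mull.
Qed.

End QuadraticLattice.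

(** * Heights on the rational points *)

Lemma le_sum4 (x y z k : int) : 0 <= x -> 0 <= y -> 0 <= z -> 0 <= k ->
  [/\ x <= x + y + z + k, y <= x + y + z + k, z <= x + y + z + k & k <= x + y + z + k].
Proof. by move=> *; split; lra. Qed.

Lemma norm_int_ge1 (t : int) : t != 0 -> 1 <= `|t|.
Proof. by rewrite -normr_gt0 gtz0_ge1. Qed.

Definition size_pair (z : int * int) : int := Num.max `|z.1| `|z.2|.

Lemma size_pair_ge z : `|z.1| <= size_pair z /\ `|z.2| <= size_pair z.
Proof. by rewrite /size_pair !le_max !lexx orbT. Qed.

Lemma size_pair_ge1 z : coprimez z.1 z.2 -> 1 <= size_pair z.
Proof.
case: z => u v /= cuv; have [] := size_pair_ge (u, v) => /= hu hv.
have [u0|u0] := eqVneq u 0; last by apply: le_trans hu; lia.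
by apply: le_trans hv; move: cuv; rewrite u0 /coprimez gcd0z; lia.
Qed.

(** Gauss's lemma for the product of the primitive forms u X + v Y and u' X + v' Y. *)
Lemma sym_prod_primitive u v u' v' : coprimez u v -> coprimez u' v' ->
  exists x y z : int, x * (u * u') + y * (u * v' + u' * v) + z * (v * v') = 1.
Proof.
move=> /eqP cuv /eqP cuv'.
have [r [s e]] : exists r s, r * u + s * v = 1 by have [r [s]] := Bezoutz u v; rewrite cuv; exists r, s.
have [r' [s' e']] : exists r s, r * u' + s * v' = 1.
  by have [r' [s']] := Bezoutz u' v'; rewrite cuv'; exists r', s'.
(* The product (r u + s v) (r' u' + s' v') = 1 reads J + k p = 1, where p = u v' is not one of the
   three coefficients. As p is a root of T ^ 2 - (u v' + u' v) T + u u' v v', rewriting k p as k p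
   (J + k p) expresses everything through them. *)
pose k := r * s' - s * r'; pose p := u * v'.
exists ((1 + k * p) * (r * r') - k ^+ 2 * (v * v')),
  ((1 + k * p) * (s * r') + k ^+ 2 * p), ((1 + k * p) * (s * s')).
pose J := r * r' * (u * u') + s * s' * (v * v') + s * r' * (u * v' + u' * v).
have eJ : J + k * p = 1.
  by rewrite -[RHS]mulr1 -{1}e -e' /J /k /p; ring.
transitivity (J + k * p * (J + k * p)).
  by rewrite /J /p; ring.
by rewrite eJ mulr1.
Qed.

(** Two integers whose sum is at most M and whose product is at most M ^ 2 in absolute value are at
    most 2 M; this is applied to u v' and u' v, whose product is (u u') (v v'). *)
Lemma size_pair_prod z z' (M : int) :
    `|z.1 * z'.1| <= M -> `|z.1 * z'.2 + z'.1 * z.2| <= M -> `|z.2 * z'.2| <= M ->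
  size_pair z * size_pair z' <= 2 * M.
Proof.
case: z z' => [u v] [u' v'] /= h1 h2 h3; rewrite /size_pair /=.
have key (p q : int) : `|p + q| <= M -> `|p * q| <= M * M -> `|p| <= 2 * M.
  move=> pq1 pq2; rewrite leNgt; apply/negP => pM.
  have qM : M < `|q| by lia.
  move: pq2; rewrite normrM leNgt => /negP; apply; nia.
have e : u * v' * (u' * v) = u * u' * (v * v') by ring.
have e2 : `|u * v' * (u' * v)| <= M * M by rewrite e normrM ler_pM.
have k1 := key _ _ h2 e2.
have k2 : `|u' * v| <= 2 * M by apply: (key _ (u * v')); [rewrite addrC | rewrite [u' * v * _]mulrC].
have M0 : 0 <= M by apply: le_trans h1.
rewrite !normrM in h1 h3 k1 k2.
by case: (leP `|u| `|v|) => _; case: (leP `|u'| `|v'|) => _; lia.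
Qed.

(* The duplication and addition formulas in projective form: if (u : v) and
   (u' : v') are the x-coordinates of P and Q, then the product and the sum of
   the x-coordinates of P + Q and P - Q are prodN / denN and sumN / denN. *)
Section Forms.
Variables (K : comNzRingType) (a b u v u' v' : K).

Definition prodN : K :=
  (u * u' - a * (v * v')) ^+ 2 - 4 * b * (u * v' + u' * v) * (v * v').
Definition sumN : K :=
  2 * ((u * v' + u' * v) * (a * (v * v') + u * u') + 2 * b * (v * v') ^+ 2).
Definition denN : K := (u * v' + u' * v) ^+ 2 - 4 * (u * u') * (v * v').

End Forms.

Section FormIdentities.
Variables (K : numFieldType) (a b : K).

(** The abscissas of P + Q and P - Q enter through their symmetric functions, which depend only on
    those of P and Q; t is the projective scaling. *)
Definition proportionalN (u v u' v' w1 w2 w1' w2' : K) := exists2 t : K, t != 0 &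
  [/\ prodN a b u v u' v' = t * (w1 * w1'), sumN a b u v u' v' = t * (w1 * w2' + w1' * w2)
    & denN u v u' v' = t * (w2 * w2')].

Lemma formN_sym u v u' v' w1 w2 w1' w2' :
  proportionalN u v u' v' w1 w2 w1' w2' -> proportionalN u v u' v' w1' w2' w1 w2.
Proof.
case=> t t0 [e1 e2 e3]; exists t => //.
by rewrite e1 e2 e3; split; congr (_ * _); [rewrite mulrC | rewrite addrC | rewrite mulrC].
Qed.

Lemma formN_zero u v : proportionalN u v 1 0 u v u v.
Proof. by exists 1; rewrite ?oner_neq0 // /prodN /sumN /denN; split; ring. Qed.

Lemma formN_zerol u v : proportionalN 1 0 u v u v u v.
Proof. by exists 1; rewrite ?oner_neq0 // /prodN /sumN /denN; split; ring. Qed.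

Lemma formN_two_torsion x v : x ^+ 3 + a * x + b = 0 -> 3 * x ^+ 2 + a != 0 -> v != 0 ->
  proportionalN (x * v) v (x * v) v 1 0 1 0.
Proof.
move=> w0 ca v0; exists (v ^+ 4 * (3 * x ^+ 2 + a) ^+ 2).
  by rewrite mulf_neq0 ?expf_neq0.
rewrite /prodN /sumN /denN; split.
- transitivity (v ^+ 4 * ((3 * x ^+ 2 + a) ^+ 2
    - 8 * x * (x ^+ 3 + a * x + b))); first by ring.
  by rewrite w0; ring.
- transitivity (v ^+ 4 * 4 * (x ^+ 3 + a * x + b)); first by ring.
  by rewrite w0; ring.
- by ring.
Qed.

Lemma formN_double x y v v3 (x3 := ((3 * x ^+ 2 + a) / (2 * y)) ^+ 2 - x - x) :
    y ^+ 2 = x ^+ 3 + a * x + b -> y != 0 -> v != 0 -> v3 != 0 ->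
  proportionalN (x * v) v (x * v) v (x3 * v3) v3 1 0.
Proof.
move=> w y0 v0 v30; exists (4 * y ^+ 2 * v ^+ 4 / v3).
  by rewrite !mulf_neq0 ?expf_neq0 ?invr_eq0 ?pnatr_eq0.
rewrite /prodN /sumN /denN; split.
- transitivity (v ^+ 4 * 4 * y ^+ 2 * x3); last by field.
  transitivity (v ^+ 4 * ((3 * x ^+ 2 + a) ^+ 2
      - 8 * x * (x ^+ 3 + a * x + b))); first by ring.
  by rewrite -w /x3; field.
- transitivity (v ^+ 4 * 4 * (x ^+ 3 + a * x + b)); first by ring.
  by rewrite -w; field.
- by ring.
Qed.

Lemma formN_chord x1 y1 x2 y2 v1 v2 v3 v4
    (x3 := ((y2 - y1) / (x2 - x1)) ^+ 2 - x1 - x2)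
    (x4 := ((- y2 - y1) / (x2 - x1)) ^+ 2 - x1 - x2) :
    y1 ^+ 2 = x1 ^+ 3 + a * x1 + b -> y2 ^+ 2 = x2 ^+ 3 + a * x2 + b ->
    x1 != x2 -> v1 != 0 -> v2 != 0 -> v3 != 0 -> v4 != 0 ->
  proportionalN (x1 * v1) v1 (x2 * v2) v2 (x3 * v3) v3 (x4 * v4) v4.
Proof.
move=> w1 w2 x12 v10 v20 v30 v40; have d : x2 - x1 != 0 by rewrite subr_eq0 eq_sym.
have ha : a = (y2 ^+ 2 - y1 ^+ 2 - x2 ^+ 3 + x1 ^+ 3) / (x2 - x1).
  by rewrite w1 w2; field.
have hb : b = y1 ^+ 2 - x1 ^+ 3 - a * x1 by rewrite w1; ring.
pose t := (v1 * v2 * (x2 - x1)) ^+ 2.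
exists (t / (v3 * v4)); first by rewrite !mulf_neq0 ?invr_eq0 ?mulf_neq0 ?expf_neq0 ?mulf_neq0.
rewrite /prodN /sumN /denN; split.
- transitivity (t * (x3 * x4)); last by field; rewrite v30 v40.
  by rewrite hb ha /t /x3 /x4; field.
- transitivity (t * (x3 + x4)); last by field; rewrite v30 v40.
  by rewrite hb ha /t /x3 /x4; field.
- by rewrite /t; field; rewrite v30 v40.
Qed.

End FormIdentities.

Section NaiveHeight.
Variables (E : weierstrass) (nsE : nonsingular E).
Local Notation G := (ec nsE rat).
Local Notation a := E.1.
Local Notation b := E.2.
Implicit Types P Q : G.

Definition xpair (P : option (rat * rat)) : int * int :=
  if P is Some (x, _) then (numq x, denq x) else (1, 0).

Lemma xpair_coprime P : coprimez (xpair P).1 (xpair P).2.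
Proof.
case: (point_val P) => [[x y]|] //=.
by rewrite /coprimez /gcdz; have := coprime_num_den x; rewrite /coprime => /eqP ->.
Qed.

Definition nheight P : int := size_pair (xpair P).

Lemma nheight_ge1 P : 1 <= nheight P.
Proof. exact: size_pair_ge1 (xpair_coprime P). Qed.

Lemma xpairN P : xpair (- P) = xpair P.
Proof. by rewrite -[point_val (- P)]/(opp_raw P); case: (point_val P) => [[x y]|]. Qed.

Definition proportional (z z' w w' : int * int) := proportionalN (a%:~R : rat) b%:~R
  z.1%:~R z.2%:~R z'.1%:~R z'.2%:~R w.1%:~R w.2%:~R w'.1%:~R w'.2%:~R.

Lemma proportional_double P :
  proportional (xpair P) (xpair P) (xpair (P + P)) (xpair (P - P)).
Proof.
rewrite subrr; have [->|[x [y eP]]] := pointP P.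
  by rewrite (addr0 (0 : G)); apply: formN_zero.
have w := curve_eq eP; rewrite horner_cubic in w.
rewrite eP -[point_val (P + P)]/(add_raw E P P) eP /= eqxx /=.
have den0 (z : rat) : (denq z)%:~R != 0 :> rat by rewrite intr_eq0 denq_neq0.
rewrite /proportional /= numqE.
have -> : (y == - y) = (y == 0) by rewrite -addr_eq0 -mulr2n mulrn_eq0.
case: eqP => [y0|/eqP y0] /=.
  have w0 : x ^+ 3 + a%:~R * x + b%:~R = 0 by rewrite -w y0 expr0n.
  exact: formN_two_torsion w0 (cubic_simple_root nsE w0) (den0 x).
by rewrite numqE; apply: formN_double.
Qed.

Lemma proportional_add P Q :
  proportional (xpair P) (xpair Q) (xpair (P + Q)) (xpair (P - Q)).
Proof.
have [->|[x1 [y1 eP]]] := pointP P.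
  by rewrite (add0r Q) (sub0r Q) xpairN; apply: formN_zerol.
have [->|[x2 [y2 eQ]]] := pointP Q.
  by rewrite (addr0 P) (subr0 P); apply: formN_zero.
have [x12|x12] := eqVneq x1 x2.
  subst x2; case: (ec_same_x eP eQ) => ->; first exact: proportional_double.
  rewrite addrC; apply: formN_sym.
  by have := proportional_double (- Q); rewrite /proportional !subrr !xpairN.
have den0 (z : rat) : (denq z)%:~R != 0 :> rat by rewrite intr_eq0 denq_neq0.
have w1 := curve_eq eP; rewrite horner_cubic in w1.
have w2 := curve_eq eQ; rewrite horner_cubic in w2.
rewrite -[point_val (P + Q)]/(add_raw E P Q) -[point_val (P - Q)]/(add_raw E P (opp_raw Q)).
rewrite eP eQ /= x12 /proportional /= !numqE.
exact: formN_chord.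
Qed.

(** By [sym_prod_primitive] some integral combination of the right-hand sides equals t; the same
    combination of the left-hand sides is an integer. *)
Lemma proportional_int z z' w w' : proportional z z' w w' ->
    coprimez w.1 w.2 -> coprimez w'.1 w'.2 ->
  exists2 t : int, t != 0 & [/\ prodN a b z.1 z.2 z'.1 z'.2 = t * (w.1 * w'.1),
    sumN a b z.1 z.2 z'.1 z'.2 = t * (w.1 * w'.2 + w'.1 * w.2)
    & denN z.1 z.2 z'.1 z'.2 = t * (w.2 * w'.2)].
Proof.
case: z z' w w' => [u v] [u' v'] [w1 w2] [w1' w2'] [t t0 /= [e1 e2 e3]] cw cw'.
have [x [y [k e]]] := sym_prod_primitive cw cw'.
pose n := x * prodN a b u v u' v' + y * sumN a b u v u' v' + k * denN u v u' v'.
have E1 : (prodN a b u v u' v')%:~R = t * (w1%:~R * w1'%:~R).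
  by rewrite -e1 /prodN; ring.
have E2 : (sumN a b u v u' v')%:~R = t * (w1%:~R * w2'%:~R + w1'%:~R * w2%:~R).
  by rewrite -e2 /sumN; ring.
have E3 : (denN u v u' v')%:~R = t * (w2%:~R * w2'%:~R).
  by rewrite -e3 /denN; ring.
have tn : t = n%:~R.
  have nE (p q r : int) : (x * p + y * q + k * r)%:~R
      = x%:~R * p%:~R + y%:~R * q%:~R + k%:~R * r%:~R :> rat.
    by rewrite !(intrD, intrM).
  rewrite /n nE E1 E2 E3 -[LHS]mulr1 -[1 in LHS]/(1%:~R) -e nE.
  by rewrite !(intrD, intrM); ring.
exists n; first by move: t0; rewrite tn intr_eq0.
clearbody n; split; apply: (@intr_inj rat).
- by rewrite E1 tn 2!intrM.
- by rewrite E2 tn intrM intrD !intrM.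
- by rewrite E3 tn 2!intrM.
Qed.

Lemma forms_bound (u v u' v' H H' : int) :
    `|u| <= H -> `|v| <= H -> `|u'| <= H' -> `|v'| <= H' ->
  let M := 8 * ((1 + `|a|) ^+ 2 + `|b|) * (H * H') ^+ 2 in
  [/\ `|prodN a b u v u' v'| <= M, `|sumN a b u v u' v'| <= M & `|denN u v u' v'| <= M].
Proof.
move=> hu hv hu' hv' M; rewrite /prodN /sumN /denN.
have mulb (x y X Y : int) : `|x| <= X -> `|y| <= Y -> `|x * y| <= X * Y.
  by move=> hx hy; rewrite normrM ler_pM.
have addb (x y X Y : int) : `|x| <= X -> `|y| <= Y -> `|x + y| <= X + Y.
  by move=> hx hy; apply: le_trans (ler_normD _ _) _; apply: lerD.
have hU := mulb _ _ _ _ hu hu'; have hV := mulb _ _ _ _ hv hv'.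
have hS := addb _ _ _ _ (mulb _ _ _ _ hu hv') (mulb _ _ _ _ hu' hv).
rewrite (mulrC H' H) in hS.
move: hU hV hS @M; move: (u * u') (v * v') (u * v' + u' * v) (H * H').
move=> U V S K hU hV hS M.
have K0 : 0 <= K by apply: le_trans hU.
have hA : `|a| <= `|a| by []; have hB : `|b| <= `|b| by [].
have K2 : 0 <= K ^+ 2 by rewrite sqr_ge0.
have aK2 := mulr_ge0 (normr_ge0 a) K2; have bK2 := mulr_ge0 (normr_ge0 b) K2.
have aaK2 := mulr_ge0 (normr_ge0 a) aK2.
have hV2 := mulb _ _ _ _ hV hV.
split.
- have haV := mulb _ _ _ _ hA hV; rewrite -normrN in haV.
  have h1 := addb _ _ _ _ hU haV; have h2 := mulb _ _ _ _ h1 h1.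
  have h3 := mulb (-4) _ 4 _ (lexx _) (mulb _ _ _ _ hB (mulb _ _ _ _ hS hV)).
  apply: le_trans (_ : _ <= (K + `|a| * K) * (K + `|a| * K) + 4 * (`|b| * ((K + K) * K))) _.
    have -> : (U - a * V) ^+ 2 - 4 * b * S * V
      = (U - a * V) * (U - a * V) + -4 * (b * (S * V)) by ring.
    exact: addb.
  by rewrite /M; lra.
- have h1 := mulb _ _ _ _ hS (addb _ _ _ _ (mulb _ _ _ _ hA hV) hU).
  have h2 := mulb 2 _ 2 _ (lexx _) (mulb _ _ _ _ hB hV2).
  have h3 := mulb 2 _ 2 _ (lexx _) (addb _ _ _ _ h1 h2).
  have -> : 2 * (S * (a * V + U) + 2 * b * V ^+ 2)
    = 2 * (S * (a * V + U) + 2 * (b * (V * V))) by ring.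
  by apply: le_trans h3 _; rewrite /M; lra.
- have h1 := mulb _ _ _ _ hS hS.
  have h2 := mulb (-4) _ 4 _ (lexx _) (mulb _ _ _ _ hU hV).
  have -> : S ^+ 2 - 4 * U * V = S * S + -4 * (U * V) by ring.
  by apply: le_trans (addb _ _ _ _ h1 h2) _; rewrite /M; lra.
Qed.

(** Twice the constant of [forms_bound]; the factor 2 is that of [size_pair_prod]. *)
Definition upper_const : int := 16 * ((1 + `|a|) ^+ 2 + `|b|).

Lemma nheight_upper P Q :
  nheight (P + Q) * nheight (P - Q) <= upper_const * (nheight P * nheight Q) ^+ 2.
Proof.
have [t t0] := proportional_int (proportional_add P Q) (xpair_coprime _) (xpair_coprime _).
have [hu hv] := size_pair_ge (xpair P); have [hu' hv'] := size_pair_ge (xpair Q).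
have /= := forms_bound hu hv hu' hv'; rewrite -/(nheight P) -/(nheight Q).
set M := 8 * _ * _ ^+ 2 => -[b1 b2 b3] [e1 e2 e3].
have drop x y : y = t * x -> `|y| <= M -> `|x| <= M.
  move=> ->; rewrite normrM; apply: le_trans; apply: ler_peMl => //.
  exact: norm_int_ge1.
have := size_pair_prod (drop _ _ e1 b1) (drop _ _ e2 b2) (drop _ _ e3 b3).
by congr (_ <= _); rewrite /M /upper_const; ring.
Qed.

Definition cubic_size (c0 c1 c2 c3 : int) : int := `|c0| + `|c1| + `|c2| + `|c3|.

Lemma cubic_size_ge0 c0 c1 c2 c3 : 0 <= cubic_size c0 c1 c2 c3.
Proof. by rewrite !addr_ge0. Qed.

Lemma cubic_form_bound (c0 c1 c2 c3 u v H : int) : `|u| <= H -> `|v| <= H ->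
  `|c0 * u ^+ 3 + c1 * u ^+ 2 * v + c2 * u * v ^+ 2 + c3 * v ^+ 3|
    <= cubic_size c0 c1 c2 c3 * H ^+ 3.
Proof.
move=> hu hv; have H0 : 0 <= H by apply: le_trans hu.
have hM (x y X Y : int) : `|x| <= X -> `|y| <= Y -> `|x * y| <= X * Y.
  by move=> hx hy; rewrite normrM ler_pM.
have hD (x y X Y : int) : `|x| <= X -> `|y| <= Y -> `|x + y| <= X + Y.
  by move=> hx hy; apply: le_trans (ler_normD _ _) _; apply: lerD.
have hX (x : int) k : `|x| <= H -> `|x ^+ k| <= H ^+ k.
  by move=> hx; rewrite normrX lerXn2r // nnegrE.
rewrite /cubic_size !mulrDl; apply: (hD _ (c3 * _)); first apply: (hD _ (c2 * _ * _));
  first apply: (hD (c0 * _)).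
- by apply: (hM) => //; apply: hX.
- rewrite -mulrA [H ^+ 3]exprSr; apply: (hM) => //.
  by apply: (hM) => //; apply: hX.
- rewrite -mulrA [H ^+ 3]exprS; apply: (hM) => //.
  by apply: (hM) => //; apply: hX.
- by apply: (hM) => //; apply: hX.
Qed.

(** The coefficient sizes of f1, g1, f2 and g2 in the duplication identities of [nheight_double], in
    this order; the sum bounds each of them. *)
Definition lower_const : int :=
  cubic_size 0 12 0 (16 * a) + cubic_size (- 3) 0 (5 * a) (27 * b)
  + cubic_size (4 * (4 * a ^+ 3 + 27 * b ^+ 2)) (- (4 * a ^+ 2 * b))
      (4 * a * (3 * a ^+ 3 + 22 * b ^+ 2)) (12 * b * (a ^+ 3 + 8 * b ^+ 2))
  + cubic_size (a ^+ 2 * b) (a * (5 * a ^+ 3 + 32 * b ^+ 2))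
      (2 * b * (13 * a ^+ 3 + 96 * b ^+ 2)) (- (3 * a ^+ 2 * (a ^+ 3 + 8 * b ^+ 2))).

(* The classical identities f1 * F + g1 * G = 4 disc * v ^ 7 and
   f2 * F + g2 * G = 4 disc * u ^ 7, where x(2P) = F / G in terms of x(P) = u / v. *)
Lemma nheight_double P : nheight P ^+ 4 <= 2 * lower_const * nheight (P *+ 2).
Proof.
rewrite mulr2n.
have cop := xpair_coprime P; have cop2 := xpair_coprime (P + P).
(* P - P has the pair (1, 0), which reduces proportionality to F = t w1 and G = t w2. *)
have := proportional_double P; rewrite subrr => /proportional_int[//|//|t t0 /=].
rewrite !mulr1 mulr0 add0r mul1r => -[eF eG _]; move: cop eF eG cop2.
rewrite -[add_raw E P P]/(point_val (P + P)) /nheight; set H := size_pair (xpair P).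
set H2 := size_pair _; have := size_pair_ge (xpair P); have := size_pair_ge (xpair (P + P)).
rewrite -/H -/H2; have : H = `|(xpair P).1| \/ H = `|(xpair P).2|.
  by rewrite /H /size_pair; case: leP; [right | left].
move: H H2 (xpair P) (xpair (P + P)) => H H2 [u v] [w1 w2] /= Huv [h1 h2] [hu hv] cop eF eG cop2.
have H0 : 0 <= H by apply: le_trans hu.
set F := prodN _ _ _ _ _ _ in eF; set Gg := sumN _ _ _ _ _ _ in eG.
pose D := 4 * (4 * a ^+ 3 + 27 * b ^+ 2).
have D0 : D != 0 by rewrite mulf_neq0.
pose f1 := 0 * u ^+ 3 + 12 * u ^+ 2 * v + 0 * u * v ^+ 2 + (16 * a) * v ^+ 3.
pose g1 := (- 3) * u ^+ 3 + 0 * u ^+ 2 * v + (5 * a) * u * v ^+ 2 + (27 * b) * v ^+ 3.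
pose f2 := D * u ^+ 3 + (- (4 * a ^+ 2 * b)) * u ^+ 2 * v
  + (4 * a * (3 * a ^+ 3 + 22 * b ^+ 2)) * u * v ^+ 2 + (12 * b * (a ^+ 3 + 8 * b ^+ 2)) * v ^+ 3.
pose g2 := (a ^+ 2 * b) * u ^+ 3 + (a * (5 * a ^+ 3 + 32 * b ^+ 2)) * u ^+ 2 * v
  + (2 * b * (13 * a ^+ 3 + 96 * b ^+ 2)) * u * v ^+ 2
  + (- (3 * a ^+ 2 * (a ^+ 3 + 8 * b ^+ 2))) * v ^+ 3.
have e1 : D * v ^+ 7 = f1 * F + g1 * Gg.
  by rewrite /D /f1 /g1 /F /Gg /prodN /sumN; ring.
have e2 : D * u ^+ 7 = f2 * F + g2 * Gg.
  by rewrite /f2 /g2 /D /F /Gg /prodN /sumN; ring.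
have bnd x y f g : D * x = f * F + g * Gg ->
    `|f| <= y * H ^+ 3 -> `|g| <= y * H ^+ 3 -> `|D| * `|x| <= 2 * y * H ^+ 3 * (`|t| * H2).
  move=> e hf hg; rewrite -normrM e eF eG.
  have -> : 2 * y * H ^+ 3 * (`|t| * H2) = y * H ^+ 3 * (`|t| * H2) + y * H ^+ 3 * (`|t| * H2).
    by ring.
  apply: le_trans (ler_normD _ _) _; apply: lerD.
    by rewrite normrM ler_pM // normrM ler_wpM2l.
  by rewrite normrM ler_pM // normrM ler_wpM2l.
(* The factor t lost in reducing F / G is bounded: it divides D u ^ 7 and D v ^ 7, with u and v
   coprime. *)
have tD : `|t| <= `|D|.
  have tu : (t %| D * u ^+ 7)%Z.
    by rewrite e2 eF eG !(mulrCA _ t) -mulrDr dvdz_mulr.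
  have tv : (t %| D * v ^+ 7)%Z.
    by rewrite e1 eF eG !(mulrCA _ t) -mulrDr dvdz_mulr.
  have /coprimezP[[r s] /= rs] : coprimez (u ^+ 7) (v ^+ 7).
    by rewrite coprimezXl ?coprimezXr.
  have /dvdzP[k Dk] : (t %| D)%Z.
    by rewrite -[D]mulr1 -rs mulrDr (mulrCA D r) (mulrCA D s) rpredD // dvdz_mull.
  rewrite Dk normrM; apply: ler_peMl => //; apply: norm_int_ge1.
  by apply: contraNneq D0 => k0; rewrite Dk k0 mul0r.
have LC0 : 0 <= lower_const by rewrite !addr_ge0 // cubic_size_ge0.
have [l1 l2 l3 l4] := le_sum4 (cubic_size_ge0 0 12 0 (16 * a))
  (cubic_size_ge0 (- 3) 0 (5 * a) (27 * b))
  (cubic_size_ge0 (4 * (4 * a ^+ 3 + 27 * b ^+ 2)) (- (4 * a ^+ 2 * b))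
      (4 * a * (3 * a ^+ 3 + 22 * b ^+ 2)) (12 * b * (a ^+ 3 + 8 * b ^+ 2)))
  (cubic_size_ge0 (a ^+ 2 * b) (a * (5 * a ^+ 3 + 32 * b ^+ 2))
      (2 * b * (13 * a ^+ 3 + 96 * b ^+ 2)) (- (3 * a ^+ 2 * (a ^+ 3 + 8 * b ^+ 2)))).
have cmp (c : int) f : `|f| <= c * H ^+ 3 -> c <= lower_const -> `|f| <= lower_const * H ^+ 3.
  by move=> hf cl; apply: le_trans hf _; rewrite ler_wpM2r // exprn_ge0.
have H7 : `|D| * H ^+ 7 <= 2 * lower_const * H ^+ 3 * (`|t| * H2).
  have k2 := bnd _ lower_const _ _ e2; have k1 := bnd _ lower_const _ _ e1.
  case: Huv => eH; rewrite {1}eH -normrX.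
    by apply: k2; [apply: cmp (cubic_form_bound _ _ _ _ hu hv) l3
                  | apply: cmp (cubic_form_bound _ _ _ _ hu hv) l4].
  by apply: k1; [apply: cmp (cubic_form_bound _ _ _ _ hu hv) l1
                | apply: cmp (cubic_form_bound _ _ _ _ hu hv) l2].
have H_gt0 : 0 < H.
  rewrite lt_neqAle H0 andbT eq_sym; apply/eqP => H00; move: hu hv cop.
  by rewrite H00 !normr_le0 => /eqP -> /eqP ->.
have H2_ge0 : 0 <= H2 by apply: le_trans h1.
have H3 : 0 < `|D| * H ^+ 3 by rewrite mulr_gt0 ?normr_gt0 ?exprn_gt0.
rewrite -(ler_pM2l H3) -[leLHS]mulrA -exprD; apply: le_trans H7 _.
rewrite -[1 + 1]/(2 : int) -(mulrA `|D|) (mulrC `|D|) mulrCA.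
have -> (x y : int) : x * (2 * lower_const * H2) * y = 2 * lower_const * x * (y * H2) by ring.
by rewrite mulrCA ler_wpM2l ?ler_wpM2r // !mulr_ge0 ?exprn_ge0.
Qed.

Lemma nheight_northcott (B : int) : exists L : seq G, forall P, nheight P <= B -> P \in L.
Proof.
have fiber z : exists L : seq G, forall P, xpair P = z -> P \in L.
  have [[P0 e0]|no] := pselect (exists P : G, xpair P = z); last first.
    by exists [::] => P e; case: no; exists P.
  exists [:: P0; - P0; 0] => P e; rewrite !inE.
  have [->|[x [y eP]]] := pointP P; first by rewrite eqxx !orbT.
  have [P00|[x0 [y0 eP0]]] := pointP P0.
    move: e0; rewrite P00 -e eP /= => -[nx dx].
    by have := denq_neq0 x; rewrite -dx eqxx.
  move: e0; rewrite -e eP eP0 => -[nx dx].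
  have xx : x = x0 by rewrite -(divq_num_den x) -(divq_num_den x0) nx dx.
  by rewrite xx in eP; case: (ec_same_x eP eP0) => ->; rewrite eqxx ?orbT.
have fibers (zs : seq (int * int)) : exists L : seq G, forall P, xpair P \in zs -> P \in L.
  elim: zs => [|z zs [L HL]]; first by exists [::].
  have [L' HL'] := fiber z; exists (L' ++ L) => P.
  rewrite inE mem_cat => /orP[/eqP/HL' -> //|/HL ->]; exact: orbT.
pose ints := [seq (k%:Z - `|B|) | k <- iota 0 (2 * `|B| + 1)%N].
have intsP (x : int) : `|x| <= B -> x \in ints.
  move=> xB; apply/mapP; exists (absz (x + `|B|)); last by lia.
  by rewrite mem_iota; lia.
have [L HL] := fibers [seq (x, y) | x <- ints, y <- ints].
exists L => P hP; apply: HL; have [h1 h2] := size_pair_ge (xpair P).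
apply/allpairsP; exists (xpair P).
by split; [apply: intsP; apply: le_trans hP | apply: intsP; apply: le_trans hP | case: xpair].
Qed.

Variable R : realType.

Definition log_height P : R := ln (nheight P)%:~R.

Let nheightR_ge1 P : 1 <= (nheight P)%:~R :> R.
Proof. by rewrite -[1]/(1%:~R) ler_int nheight_ge1. Qed.

Let nheightR_gt0 P : 0 < (nheight P)%:~R :> R.
Proof. exact: lt_le_trans (nheightR_ge1 P). Qed.

Lemma log_height_ge0 P : 0 <= log_height P.
Proof. exact: ln_ge0. Qed.

Let upper_gt0 : 0 < upper_const%:~R :> R.
Proof. by rewrite ltr0z /upper_const; have : 0 <= (1 + `|a|) ^+ 2 :> int by []; lia. Qed.

Let lower_gt0 : 0 < (2 * lower_const)%:~R :> R.
Proof.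
rewrite ltr0z; have := nheight_double (0 : G); rewrite mul0rn.
have -> : nheight (0 : G) = 1 by [].
by rewrite expr1n mulr1; apply: lt_le_trans.
Qed.

Lemma log_height_upper P Q :
  log_height (P + Q) + log_height (P - Q)
    <= 2 * log_height P + 2 * log_height Q + ln upper_const%:~R.
Proof.
rewrite /log_height -lnM ?posrE // -intrM.
apply: le_trans (_ : _ <= ln (upper_const * (nheight P * nheight Q) ^+ 2)%:~R) _.
  by rewrite ler_ln ?posrE ?ler_int ?nheight_upper // intrM ?mulr_gt0 //
    rmorphXn /= intrM ?exprn_gt0 ?mulr_gt0.
rewrite intrM rmorphXn /= intrM lnM ?posrE ?exprn_gt0 ?mulr_gt0 //.
rewrite lnXn ?mulr_gt0 // lnM ?posrE // -mulr_natl.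
lra.
Qed.

Lemma log_height_double P : 4 * log_height P <= log_height (P *+ 2) + ln (2 * lower_const)%:~R.
Proof.
rewrite /log_height mulr_natl -lnXn // -lnM ?posrE // -intrM -rmorphXn /=.
rewrite ler_ln ?posrE ?rmorphXn ?exprn_gt0 //=; last by rewrite intrM mulr_gt0.
by rewrite -rmorphXn /= ler_int mulrC nheight_double.
Qed.

Lemma ec_reduced_pair (P1 P2 : G) : indep P1 P2 -> exists Q1 Q2 : G,
  forall (n : nat) (x y : int) Q, (0 < n)%N -> Q1 *~ x + Q2 *~ y = Q *+ n ->
    (n %| x)%Z /\ (n %| y)%Z.
Proof.
pose K := Num.max (ln upper_const%:~R) (ln (2 * lower_const)%:~R) : R.
have upper P Q : log_height (P + Q) + log_height (P - Q)
    <= 2 * log_height P + 2 * log_height Q + K.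
  by apply: le_trans (log_height_upper P Q) _; rewrite lerD2l le_max lexx.
have double P : 4 * log_height P <= log_height (P *+ 2) + K.
  by apply: le_trans (log_height_double P) _; rewrite lerD2l le_max lexx orbT.
pose q := canonical_height log_height K.
apply: (@reduced_pair R G q); first exact: canonical_height_parallelogram log_height_ge0 upper double.
  exact: canonical_height_ge0 log_height_ge0 upper double.
(* Finiteness passes from the naive height to q, which differs from it by a bounded amount. *)
move=> M; have [c hc] : exists c, forall P, log_height P <= q P + c.
  exists ((2 * `|K| + log_height 0) / 3) => P.
  have := canonical_height_bound log_height_ge0 upper double P.
  by rewrite -/q ler_norml; lra.
have [L HL] := nheight_northcott (Num.trunc (expR (M + c))).+1.
exists L => P qM; apply: HL; rewrite -(ler_int R) /=.
apply: le_trans (ltW (truncnS_gt _)).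
rewrite -(lnK (nheightR_gt0 P)) ler_expR.
by apply: le_trans (hc P) _; rewrite lerD2r.
Qed.

End NaiveHeight.

(** * The Kummer map *)

Section MapPoint.
Variables (E : weierstrass) (F F' : fieldType) (f : {rmorphism F -> F'}).

Lemma map_pointD (P Q : Defs.point E F) :
  map_point f (addp P Q) = addp (map_point f P) (map_point f Q).
Proof.
apply: val_inj; case: P => -[[x1 y1]|] h1; case: Q => -[[x2 y2]|] h2 //=.
have feq u v : (f u == f v) = (u == v) by apply: inj_eq; apply: fmorph_inj.
rewrite feq -[- f y2]rmorphN feq.
have slope l u v u' : map_raw f (add_slope l u v u') = add_slope (f l) (f u) (f v) (f u').
  by rewrite /add_slope /= !(rmorphB, rmorphM, rmorphXn).
case: ifP => _; first by rewrite slope fmorph_div !rmorphB.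
case: ifP => _ //; rewrite slope fmorph_div rmorphD [f (2 * _)]rmorphM.
by rewrite [f (3 * _)]rmorphM rmorphXn rmorph_int !rmorph_nat.
Qed.

Lemma map_pointN (P : Defs.point E F) : map_point f (oppp P) = oppp (map_point f P).
Proof. by apply: val_inj; case: P => -[[x y]|] h //=; rewrite rmorphN. Qed.

Lemma map_point_inj : injective (map_point f : Defs.point E F -> Defs.point E F').
Proof.
move=> P Q /(congr1 (@point_val E F')) e; apply: val_inj; move: e.
case: P => -[[x y]|] hP; case: Q => -[[x' y']|] hQ //= [] /fmorph_inj -> /fmorph_inj -> //.
Qed.

End MapPoint.

(** * The fixed field of the absolute Galois group *)

Lemma algC_aut_bij (nu : {rmorphism algC -> algC}) : bijective nu.
Proof. by exists (algC_invaut nu); [apply: algC_autK | apply: algC_invautK]. Qed.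

Lemma galQ_exists (nu : {rmorphism algC -> algC}) : exists s : galQ, s =1 nu.
Proof.
have fixnu q : nu (ratr q) = ratr q by rewrite fmorph_rat.
by exists (@Defs.Gal _ _ (ratr : {rmorphism rat -> algC}) nu (algC_aut_bij nu) fixnu).
Qed.

(** z lies in the splitting field of its minimal polynomial, a finite Galois extension of Q each of
    whose automorphisms extends to Qbar; finite Galois theory then applies. *)
Lemma gal_fixed_rat (z : algC) : (forall s : galQ, s z = z) -> exists q : rat, z = ratr q.
Proof.
move=> fixz; have [p [Dp mon_p _]] := minCpolyP z.
have [rs Drs] := closed_field_poly_normal (minCpoly z).
rewrite (monicP (minCpoly_monic z)) scale1r in Drs.
have [Qs [QsC [s1 Ds1 gen]]] := num_field_exists rs.
have DQ : map_poly QsC (map_poly (in_alg Qs) p) = minCpoly z.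
  rewrite Dp -map_poly_comp; apply: eq_map_poly => q /=.
  by rewrite alg_num_field fmorph_rat.
have DpQ : map_poly (in_alg Qs) p = \prod_(r <- s1) ('X - r%:P).
  apply: (map_poly_inj QsC); rewrite DQ Drs rmorph_prod -Ds1 big_map /=.
  by apply: eq_bigr => r _; rewrite map_polyXsubC.
have Qs_ax : FieldExt_isSplittingField _ Qs.
  constructor; exists (map_poly (in_alg Qs) p).
    by apply/polyOver1P; exists p.
  by exists s1; rewrite ?DpQ ?eqpxx.
pose SQ : splittingFieldType rat := HB.pack_for (splittingFieldType rat) Qs Qs_ax.
have galQs : galois 1 {:SQ}.
  apply/and3P; split; [exact: sub1v | | exact: normalFieldf].
  by apply/separableP => y _; apply: pcharf0_separable => p'; rewrite pchar_lalg pchar_num.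
have [z1 Dz] : exists z1 : SQ, QsC z1 = z.
  have : z \in rs.
    have : root (minCpoly z) z by apply: root_minCpoly.
    by rewrite Drs root_prod_XsubC.
  by rewrite -Ds1 => /mapP[z1 _ ->]; exists z1.
have /vlineP[q Dq] : z1 \in 1%VS.
  rewrite -(galois_fixedField galQs); apply/fixedFieldP; first exact: memvf.
  move=> x _.
  have [nu Dnu] := extend_algC_subfield_aut QsC (x : {rmorphism SQ -> SQ}).
  have [s snu] := galQ_exists nu.
  by apply: (fmorph_inj QsC); rewrite Dnu Dz -snu fixz.
by exists q; rewrite -Dz Dq alg_num_field fmorph_rat.
Qed.

Section Kummer.
Variables (E : weierstrass) (nsE : nonsingular E) (n : nat).
Local Notation GQ := (ec nsE rat).
Local Notation GC := (ec nsE algC).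
Implicit Types (T : GC) (P Q : GQ).

Definition emb P : GC := map_point (ratr : {rmorphism rat -> algC}) P.

Lemma emb_inj : injective emb.
Proof. exact: map_point_inj. Qed.

Lemma embB P Q : emb (P - Q) = emb P - emb Q.
Proof. by rewrite /emb map_pointD map_pointN. Qed.

Lemma map_point_muln (F F' : numFieldType) (f : {rmorphism F -> F'}) (P : ec nsE F) m :
  (map_point f (P *+ m) : ec nsE F') = (map_point f P : ec nsE F') *+ m.
Proof.
elim: m => [|m IH]; first by rewrite !mulr0n; apply: val_inj.
by rewrite !mulrS -IH; apply: map_pointD.
Qed.

Lemma map_point_gal (s : galQ) (P : GQ) : map_point s (emb P) = emb P.
Proof.
by apply: val_inj; case: P => -[[x y]|] h //=; rewrite !gal_fix.
Qed.

Lemma gal_fixed_point (T : GC) : (forall s : galQ, map_point s T = T) ->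
  exists P : GQ, T = emb P.
Proof.
move=> fixT; have [->|[x [y eT]]] := pointP T; first by exists 0; apply: val_inj.
have [q xq] : exists q : rat, x = ratr q.
  apply: gal_fixed_rat => s; have /(congr1 (@point_val _ _)) := fixT s.
  by rewrite /= eT /= => -[].
have [r yr] : exists q : rat, y = ratr q.
  apply: gal_fixed_rat => s; have /(congr1 (@point_val _ _)) := fixT s.
  by rewrite /= eT /= => -[].
have qr : on_curve E (Some (q, r)).
  have := valP T; rewrite -[val T]/(point_val T) eT xq yr /= -rmorphXn -(rmorphXn _ 3).
  by rewrite -(rmorph_int ratr) -[(E.2)%:~R](rmorph_int ratr) -rmorphM -!rmorphD /= fmorph_eq.
by exists (Point qr); apply: val_inj; rewrite /= [LHS]eT xq yr.
Qed.

(** For n T = P this cocycle represents the image of P under the connecting map of multiplication by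
    n. *)
Definition kummer (T : GC) : galQ -> Defs.point E algC := fun s => coboundary T s.

Lemma kummerE T s : kummer T s = (map_point s T : GC) - T.
Proof. by []. Qed.

(** The values are n-torsion because n T is rational, and continuity holds because the value at s
    depends only on the images of the two coordinates of T. *)
Lemma kummer_Z1 T P : T *+ n = emb P -> Z1 n (kummer T).
Proof.
move=> nT; split.
- move=> s; rewrite mulpnE kummerE mulrnBl -map_point_muln nT map_point_gal.
  exact: (subrr (emb P)).
- move=> s; case e: (point_val T) => [[x y]|].
    exists [:: x; y] => t st; rewrite /kummer /coboundary; congr addp.
    apply: val_inj; rewrite /= e /= -(st x) ?mem_head //.
    by rewrite -(st y) // inE mem_head orbT.
  by exists [::] => t _; rewrite /kummer /coboundary; congr addp; apply: val_inj; rewrite /= e.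
move=> s t; rewrite [kummer _ _]kummerE.
have -> : map_point (Defs.gal_mul s t) T = map_point s (map_point t T).
  by apply: val_inj; case: (T) => -[[x y]|] h.
have -> : map_point s (kummer T t) = (map_point s (map_point t T) : GC) - (map_point s T : GC).
  by rewrite /kummer /coboundary map_pointD map_pointN.
by rewrite -[RHS]/((kummer T s : GC) + _) kummerE [RHS]addrC addrA subrK.
Qed.

(** The cocycle is a coboundary of T in E(Qbar), and the image of T under j trivialises it in
    E(L). *)
Lemma kummer_trivial_at (R : realType) (T : GC) v : trivial_at R v (kummer T).
Proof.
move=> K i abs _ L k _ j; exists (map_point j T) => s t st.
rewrite /kummer /coboundary map_pointD map_pointN; congr addp.
by apply: val_inj; case: (T) => -[[x y]|] h //=; rewrite !st.
Qed.

Lemma kummer_selmer (R : realType) T P : T *+ n = emb P ->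
  selmer R E n (H1_class n (kummer T)).
Proof.
move=> nT; exists (kummer T) => //; split; first exact: kummer_Z1 nT.
by move=> v _; apply: kummer_trivial_at.
Qed.

(** If the cocycles of T and T' differ by the coboundary of an n-torsion point S, then T' - T - S is
    Galois-invariant, hence a rational point Q, and n Q = P' - P. *)
Lemma kummer_inj (T T' : GC) (P P' : GQ) : T *+ n = emb P -> T' *+ n = emb P' ->
  H1_class n (kummer T) = H1_class n (kummer T') -> exists Q : GQ, P' - P = Q *+ n.
Proof.
move=> nT nT' eH; have [_ [S nS]] : H1_class n (kummer T) (kummer T').
  rewrite eH; split; first exact: kummer_Z1 nT'.
  exists (0 : GC); first by rewrite mulpnE mul0rn.
  move=> s; have -> : coboundary (0 : GC) s = point0 by apply: val_inj.
  by rewrite addp0.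
rewrite mulpnE in nS => cS; pose S' : GC := S; rewrite -/S' in nS cS.
have [Q eQ] : exists Q : GQ, T' - T - S' = emb Q.
  apply: gal_fixed_point => s.
  pose g (X : GC) : GC := map_point s X.
  have gB X Y : g (X - Y) = g X - g Y by rewrite /g map_pointD map_pointN.
  rewrite -[LHS]/(g (T' - T - S')) !gB.
  have : g T' - T' = g T - T + (g S' - S') := cS s.
  move/eqP; rewrite subr_eq => /eqP ->; move: (g T) (g S') => A B.
  rewrite addrACA -opprD -[LHS]addrA -opprD -[A + B - _ + T']addrA (addrC (A + B)) addrK.
  by rewrite addrC opprD addrA.
exists Q; apply: emb_inj.
by rewrite embB [RHS]map_point_muln -/(emb Q) -eQ !mulrnBl nS nT nT' subr0.
Qed.

End Kummer.

(** * Counting elements of the Selmer group *)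

Lemma counting_ge_card (T : choiceType) (R : realType) (I : finType) (f : I -> T) (A : set T) :
  injective f -> (forall i, A (f i)) -> (#|I|%:R%:E <= counting A :> \bar R)%E.
Proof.
move=> injf fA; rewrite /counting; case: ifPn => [/asboolP finA|_]; last exact: leey.
rewrite lee_fin ler_nat cardT -(size_map f); apply: uniq_leq_size.
  by rewrite map_inj_uniq ?enum_uniq.
by move=> _ /mapP[i _ ->]; rewrite in_fset_set // inE.
Qed.

Lemma ord_dvdz_inj n (k l : 'I_n) : (n %| l%:Z - k%:Z)%Z -> k = l.
Proof.
move=> d; apply: ord_inj; have := ltn_ord k; have := ltn_ord l.
move: (nat_of_ord k) (nat_of_ord l) d => {}k {}l /dvdzP[m em].
have [m0|m0] := eqVneq m 0; first by rewrite m0 mul0r in em; lia.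
nia.
Qed.

Section RankSelmer.
Variables (E : weierstrass) (nsE : nonsingular E) (R : realType).
Local Notation GQ := (ec nsE rat).

Lemma rank_gt1_indep : ~ (rank E R <= 1)%E -> exists P1 P2 : GQ, indep P1 P2.
Proof.
move=> rk; have [r r1 [P indP]] : exists2 r : nat, (1 < r)%N &
    exists P : 'I_r -> Defs.point E rat, independent P.
  apply: contrapT => no; apply: rk; apply: ge_ereal_sup => _ [r [P indP] <-].
  rewrite lee_fin lern1 leqNgt; apply/negP => r1; apply: no; exists r => //.
  by exists P.
pose i0 : 'I_r := Ordinal (ltnW r1); pose i1 : 'I_r := Ordinal r1.
exists (P i0), (P i1) => a b e.
pose m (i : 'I_r) : int := if i == i0 then a else if i == i1 then b else 0.
have := indP m; have -> : \big[@addp E rat/point0]_(i < r) Defs.mulpz (P i) (m i) = point0.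
  transitivity (\sum_(i < r) ((P i : GQ) *~ m i)).
    by apply: eq_bigr => i _; rewrite mulpzE.
  rewrite (bigD1 i0) //= (bigD1 i1) //= big1 ?addr0.
    exact: e.
  by move=> i /andP[/negPf ii0 /negPf ii1]; rewrite /m ii0 ii1 mulr0z.
by move=> /(_ erefl) m0; split; [exact: m0 i0 | exact: m0 i1].
Qed.

Lemma selmer_ge n : (0 < n)%N -> ~ (rank E R <= 1)%E ->
  ((n ^ 2)%:R%:E <= counting (selmer R E n) :> \bar R)%E.
Proof.
move=> n0 /rank_gt1_indep[P1 [P2 /(ec_reduced_pair R)[Q1 [Q2 red]]]].
pose P (i : 'I_n * 'I_n) : GQ := Q1 *+ i.1 + Q2 *+ i.2.
have /choice[T TP] i : exists T : ec nsE algC, T *+ n = emb (P i).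
  exact: ec_divisible.
have -> : (n ^ 2)%N = #|{: 'I_n * 'I_n}| by rewrite card_prod !card_ord.
apply: (@counting_ge_card _ R _ (fun i => H1_class n (kummer (T i)))) => [i j eH|i]; last first.
  exact: kummer_selmer (TP i).
have [Q] := kummer_inj (TP i) (TP j) eH.
have -> : P j - P i = Q1 *~ (j.1%:Z - i.1%:Z) + Q2 *~ (j.2%:Z - i.2%:Z).
  by rewrite /P !mulrzBr -!pmulrn opprD addrACA.
move=> /(red _ _ _ _ n0)[d1 d2].
by case: i j d1 d2 {eH} => [i1 i2] [j1 j2] /= /ord_dvdz_inj -> /ord_dvdz_inj ->.
Qed.

End RankSelmer.

(** * The density argument *)

Section DivisorSum.
Local Open Scope nat_scope.

(** The complementary divisors n / d are distinct and less than M. *)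
Lemma count_large_divisors n M : 0 < n -> count (fun d => n < M * d) (divisors n) <= M.
Proof.
move=> n0; rewrite -size_filter -[leqRHS](size_iota 0 M) -(size_map (fun d => n %/ d)).
apply: uniq_leq_size.
  rewrite map_inj_in_uniq ?filter_uniq ?divisors_uniq // => d e.
  rewrite !mem_filter -!dvdn_divisors // => /andP[_ dn] /andP[_ en] de.
  have nd0 : 0 < n %/ d by rewrite divn_gt0 ?(dvdn_gt0 n0 dn) // dvdn_leq.
  by apply/eqP; rewrite -(eqn_pmul2l nd0) divnK // de divnK.
move=> _ /mapP[d + ->]; rewrite mem_filter -dvdn_divisors // => /andP[lt dn].
have d0 : 0 < d by apply: dvdn_gt0 dn.
by rewrite mem_iota /= add0n ltn_divLR.
Qed.

(* A divisor n / e with e >= M is at most n / M, and fewer than M have e < M. *)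
Lemma sum_divisors_le n M : 0 < n ->
  M * (\sum_(d <- divisors n) d) <= M * M * n + n * n.
Proof.
move=> n0; rewrite big_distrr /= (bigID (fun d => n < M * d)) /=; apply: leq_add.
  apply: leq_trans (_ : \sum_(d <- divisors n | n < M * d) M * n <= _).
    rewrite big_seq_cond [leqRHS]big_seq_cond; apply: leq_sum => d /andP[dn _].
    by rewrite leq_mul2l dvdn_leq ?orbT // dvdn_divisors.
  rewrite big_const_seq iter_addn addn0 -mulnA -mulnA leq_mul2l mulnC leq_mul2r.
  by rewrite count_large_divisors // !orbT.
apply: leq_trans (_ : \sum_(d <- divisors n | ~~ (n < M * d)) n <= _).
  by apply: leq_sum => d; rewrite -leqNgt.
rewrite big_const_seq iter_addn addn0 mulnC leq_mul2r; apply/orP; right.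
apply: leq_trans (count_size _ _) _; rewrite -[leqRHS](size_iota 1 n).
apply: uniq_leq_size; first exact: divisors_uniq.
move=> d; rewrite -dvdn_divisors // mem_iota => dn.
by rewrite (dvdn_gt0 n0 dn) add1n ltnS dvdn_leq.
Qed.

End DivisorSum.

Section Density.
Import numFieldNormedType.Exports.
Variable R : realType.
Local Open Scope classical_set_scope.

Lemma curves_lt_finite (X : R) : finite_set (curves_lt X).
Proof.
pose B := (Num.trunc `|X|).+1.
pose ints := [seq (k%:Z - B%:Z) | k <- iota 0 (2 * B + 1)%N].
have intsP (x : int) : `|x| <= B%:Z -> x \in ints.
  move=> xB; apply/mapP; exists (absz (x + B%:Z)); last by lia.
  by rewrite mem_iota; lia.
apply: (@sub_finite_set _ _ [set` [seq (x, y) | x <- ints, y <- ints]]); last first.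
  exact: finite_seq.
move=> [x y] [_ hX]; apply/allpairsP; exists (x, y).
have hB : height (x, y) <= B%:Z.
  rewrite -(ler_int R); apply: le_trans (ltW hX) _.
  by apply: le_trans (ler_norm _) _; apply/ltW/truncnS_gt.
move: hB; rewrite /height ge_max /= => /andP[hx hy]; split=> //; apply: intsP => /=.
  apply: le_trans hx; rewrite normrX; have := normr_ge0 x.
  by move: `|x| => k k0; have [->|/norm_int_ge1] := eqVneq k 0; nia.
apply: le_trans hy; rewrite -real_normK ?num_real //; have := normr_ge0 y.
by move: `|y| => k k0; nia.
Qed.

(** The curve y ^ 2 = x ^ 3 + 1 has height 27; beyond this bound no denominator vanishes. *)
Lemma curves_lt_nonempty (X : R) : 27 < X -> curves_lt X (0, 1).
Proof.
move=> X27; split; last by rewrite /height /= expr0n normr0 mulr0 expr1n.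
split=> //= p pp _; rewrite dvdz1 abszX absz_nat.
by rewrite gtn_eqF // (leq_trans (prime_gt1 pp)) // -[leqLHS]expn1 leq_exp2l ?prime_gt1.
Qed.

Definition curves_seq (X : R) : seq weierstrass := finmap.enum_fset (fset_set (curves_lt X)).

Lemma mem_curves_seq X E : (E \in curves_seq X) = `[< curves_lt X E >].
Proof.
rewrite /curves_seq in_fset_set; last exact: curves_lt_finite.
by apply/idP/asboolP; rewrite inE.
Qed.

Definition high_rank (E : weierstrass) : bool := ~~ `[< (rank E R <= 1)%E >].

Lemma esum_curves X (f : weierstrass -> \bar R) : (forall E, 0 <= f E)%E ->
  (\esum_(E in curves_lt X) f E = \sum_(E <- curves_seq X) f E)%E.
Proof.
move=> f0; rewrite esum_fset //; last exact: curves_lt_finite.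
by rewrite fsbig_finite //; exact: curves_lt_finite.
Qed.

Lemma counting_ge0 (T : choiceType) (A : set T) : (0 <= counting A :> \bar R)%E.
Proof. by rewrite /counting; case: ifP => _ //; rewrite lee_fin. Qed.

Lemma counting_curves X (p : pred weierstrass) :
  counting [set E | curves_lt X E /\ p E] = (count p (curves_seq X))%:R%:E :> \bar R.
Proof.
have fin : finite_set [set E | curves_lt X E /\ p E].
  by apply: sub_finite_set (curves_lt_finite X) => E [].
rewrite /counting asboolT // -size_filter; congr (_%:R%:E).
apply: perm_size; apply: uniq_perm; rewrite ?filter_uniq ?finmap.fset_uniq //.
move=> E; rewrite in_fset_set // mem_filter mem_curves_seq.
by apply/idP/andP; rewrite inE => -[h1 h2]; split=> //; apply/asboolP.
Qed.

Lemma esum_one_curves X :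
  (\esum_(E in curves_lt X) 1 = (size (curves_seq X))%:R%:E :> \bar R)%E.
Proof.
rewrite esum_curves //; transitivity (\sum_(E <- curves_seq X) (1 : R)%:E)%E => //.
by rewrite sumEFin big_const_seq count_predT iter_addr addr0.
Qed.

Lemma size_curves_seq_gt0 X : 27 < X -> (0 < size (curves_seq X))%N.
Proof.
move=> X27; have : (0, 1) \in curves_seq X.
  by rewrite mem_curves_seq; apply/asboolP/curves_lt_nonempty.
by case: (curves_seq X).
Qed.

Lemma esum_selmer_ge n X : (0 < n)%N ->
  ((n%:R ^+ 2 * (count high_rank (curves_seq X))%:R)%:E
    <= \esum_(E in curves_lt X) counting (selmer R E n) :> \bar R)%E.
Proof.
move=> n0; rewrite esum_curves; last by move=> E; apply: counting_ge0.
apply: (@le_trans _ _ (\sum_(E <- curves_seq X | high_rank E) ((n ^ 2)%:R)%:E)%E).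
  by rewrite sumEFin lee_fin big_const_seq iter_addr addr0 natrX mulr_natr.
rewrite [leRHS](bigID high_rank) /= -[leLHS]adde0; apply: leeD.
  rewrite big_seq_cond [leRHS]big_seq_cond; apply: lee_sum => E /andP[].
  rewrite mem_curves_seq => /asboolP[[nsE _] _] /asboolPn rk.
  exact: (@selmer_ge E nsE).
by apply: sume_ge0 => E _; apply: counting_ge0.
Qed.

(** Any bound above the limit holds eventually; sigma(n) + 1 is one, and it is still o(n ^ 2). *)
Lemma high_rank_proportion n : (0 < n)%N ->
    ((\esum_(E in curves_lt X) counting (selmer R E n))
       / (\esum_(E in curves_lt X) 1))%E @[X --> (+oo%R : set_system R)]
     --> ((\sum_(d <- divisors n) d)%N%:R : R)%:E ->
  \forall X \near (+oo%R : set_system R),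
    n%:R ^+ 2 * (count high_rank (curves_seq X))%:R
      <= ((\sum_(d <- divisors n) d)%N%:R + 1) * (size (curves_seq X))%:R :> R.
Proof.
move=> n0 lim; set sigma : R := _%:R in lim *.
have lt : sigma < sigma + 1 by rewrite ltrDl.
have ev := lim _ (@nbhs_open_ereal_lt R sigma (fun x => x + 1) lt).
have big := nbhs_pinfty_gt (num_real (27 : R)).
near=> X.
have X27 : 27 < X by near: X.
have c0 : 0 < (size (curves_seq X))%:R :> R by rewrite ltr0n size_curves_seq_gt0.
have : ((\esum_(E in curves_lt X) counting (selmer R E n))
       / (\esum_(E in curves_lt X) 1) < (sigma + 1)%:E)%E by near: X.
rewrite esum_one_curves inver gt_eqF // => /ltW; rewrite lee_pdivrMr // -EFinM.
by move=> /(le_trans (esum_selmer_ge X n0)); rewrite lee_fin.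
Unshelve. all: by end_near.
Qed.

Lemma infinite_set_gt (N : set nat) m : infinite_set N -> exists2 n, N n & (m < n)%N.
Proof.
move=> infN; apply: contrapT => no; apply: infN.
apply: (@sub_finite_set _ _ `I_m.+1); last exact: finite_II.
by move=> n Nn /=; rewrite ltnS leqNgt; apply/negP => mn; apply: no; exists n.
Qed.

Lemma divisor_sum_small (N : set nat) (e : R) : infinite_set N -> 0 < e ->
  exists2 n, N n & (\sum_(d <- divisors n) d)%N%:R + 1 <= e * n%:R ^+ 2.
Proof.
(* [sum_divisors_le] amounts to sigma(n) <= M n + n ^ 2 / M. The choice M > 2 / e makes the last
   term at most e n ^ 2 / 2, and n > 2 (M + 1) / e does the same for M n + 1. *)
move=> infN e0; pose M := (Num.trunc (2 / e)).+1; have M_gt : 2 / e < M%:R := truncnS_gt _.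
pose m := Num.trunc (2 * (M%:R + 1) / e).
have [n Nn mn] := infinite_set_gt m infN; exists n => //.
have n_gt : 2 * (M%:R + 1) / e < n%:R.
  by apply: lt_le_trans (truncnS_gt _) _; rewrite ler_nat.
have n0 : (0 < n)%N by apply: leq_ltn_trans mn.
have := sum_divisors_le M n0; rewrite -(ler_nat R) natrD !natrM.
move=> h.
have nR : 1 <= n%:R :> R by rewrite ler1n.
have MR : 1 <= M%:R :> R by rewrite ler1n.
rewrite ltr_pdivrMr // in M_gt; rewrite ltr_pdivrMr // in n_gt.
have M0 : 0 < M%:R :> R by apply: lt_le_trans MR.
rewrite -(ler_pM2l M0) mulrDr mulr1.
have h1 : n%:R ^+ 2 * 2 <= n%:R ^+ 2 * (M%:R * e).
  by rewrite ler_wpM2l ?sqr_ge0 // ltW.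
have h2 : M%:R * n%:R * (2 * (M%:R + 1)) <= M%:R * n%:R * (n%:R * e).
  by rewrite ler_wpM2l ?mulr_ge0 // ltW.
have h3 : M%:R <= M%:R * n%:R :> R by rewrite ler_peMr.
by rewrite expr2 in h1 *; lra.
Qed.

Lemma low_rank_proportion (N : set nat) : infinite_set N ->
    (forall n, N n -> (0 < n)%N) ->
    (forall n, N n -> ((\esum_(E in curves_lt X) counting (selmer R E n))
       / (\esum_(E in curves_lt X) 1))%E @[X --> (+oo%R : set_system R)]
     --> ((\sum_(d <- divisors n) d)%N%:R : R)%:E) ->
  (count (predC high_rank) (curves_seq X))%:R / (size (curves_seq X))%:R
    @[X --> (+oo%R : set_system R)] --> (1 : R).
Proof.
move=> infN posN lim; apply/cvgrPdist_le => e e0.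
have [n Nn small] := divisor_sum_small infN e0.
have prop := high_rank_proportion (posN n Nn) (lim n Nn).
have big := nbhs_pinfty_gt (num_real (27 : R)).
near=> X.
have X27 : 27 < X by near: X.
have c0 : 0 < (size (curves_seq X))%:R :> R by rewrite ltr0n size_curves_seq_gt0.
have n2 : 0 < n%:R ^+ 2 :> R by rewrite exprn_gt0 // ltr0n posN.
have hX : n%:R ^+ 2 * (count high_rank (curves_seq X))%:R
    <= ((\sum_(d <- divisors n) d)%N%:R + 1) * (size (curves_seq X))%:R :> R.
  by near: X.
have cE : (size (curves_seq X))%:R = (count high_rank (curves_seq X))%:R
    + (count (predC high_rank) (curves_seq X))%:R :> R.
  by rewrite -natrD count_predC.
have -> : 1 - (count (predC high_rank) (curves_seq X))%:R / (size (curves_seq X))%:R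
    = (count high_rank (curves_seq X))%:R / (size (curves_seq X))%:R :> R.
  by apply: (mulIf (lt0r_neq0 c0)); rewrite mulrBl !divfK ?gt_eqF // mul1r cE addrK.
rewrite ger0_norm ?divr_ge0 // ler_pdivrMr // -(ler_pM2l n2).
apply: le_trans hX _; rewrite mulrA (mulrC _ e).
by rewrite ler_wpM2r.
Unshelve. all: by end_near.
Qed.

Lemma low_rank_density (N : set nat) : infinite_set N ->
    (forall n, N n -> (0 < n)%N) ->
    (forall n, N n -> ((\esum_(E in curves_lt X) counting (selmer R E n))
       / (\esum_(E in curves_lt X) 1))%E @[X --> (+oo%R : set_system R)]
     --> ((\sum_(d <- divisors n) d)%N%:R : R)%:E) ->
  (counting [set E | curves_lt X E /\ (rank E R <= 1)%E] / counting (curves_lt X))%E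
    @[X --> (+oo%R : set_system R)] --> (1 : \bar R)%E.
Proof.
move=> infN posN lim.
have := low_rank_proportion infN posN lim.
pose good X : R := (count (predC high_rank) (curves_seq X))%:R.
pose all X : R := (size (curves_seq X))%:R.
(* For X > 27 the denominator is a nonzero real, so the extended quotient is the real one. *)
have eqf : \forall X \near (+oo%R : set_system R), ((good X / all X)%:E =
    (counting [set E | curves_lt X E /\ (rank E R <= 1)%E] / counting (curves_lt X)))%E.
  have big := nbhs_pinfty_gt (num_real (27 : R)); near=> X.
  have X27 : 27 < X by near: X.
  have -> : curves_lt X = [set E | curves_lt X E /\ predT E].
    by apply/seteqP; split=> E // [].
  rewrite [counting [set E | curves_lt X E /\ predT E]]counting_curves count_predT.
  have -> : [set E | [set E | curves_lt X E /\ predT E] E /\ (rank E R <= 1)%E]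
      = [set E | curves_lt X E /\ predC high_rank E].
    apply/seteqP; split=> E /= [h1 h2].
      by case: h1 => h1 _; split=> //; rewrite negbK; apply/asboolP.
    by split=> //; apply/asboolP; rewrite -[`[< _ >]]negbK.
  rewrite counting_curves inver gt_eqF ?EFinM //.
  by rewrite ltr0n size_curves_seq_gt0.
move=> h; apply: cvg_trans (near_eq_cvg eqf) _.
by apply: cvg_EFin => //; apply: nearW.
Unshelve. all: by end_near.
Qed.

End Density.

Local Open Scope classical_set_scope.
Local Open Scope ring_scope.
Local Open Scope ereal_scope.

Theorem proposition5 (R : realType) (N : set nat)
  (N_infinite : infinite_set N)
  (N_positive : forall n : nat, N n -> (0 < n)%N)
  (average_selmer : forall n : nat, N n ->
     (\esum_(E in curves_lt X) counting (selmer R E n))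
       / (\esum_(E in curves_lt X) 1) @[X --> (+oo%R : set_system R)]
     --> ((\sum_(d <- divisors n) d)%N%:R : R)%:E) :
  counting [set E | curves_lt X E /\ rank E R <= 1] / counting (curves_lt X)
    @[X --> (+oo%R : set_system R)] --> (1 : \bar R).
Proof.
exact: low_rank_density N_infinite N_positive average_selmer.
Qed.
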